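(* Let $n\ge2$, let $1<p<\infty$ and $\beta\in\mathbb{R}$, and let $B^{(n-1)/2}$ be the Bochner–Riesz multiplier on $\mathbb{R}^n$ at the index $\lambda=(n-1)/2$. Suppose that there is a constant $c$, independent of $w$, such that $$\|B^{(n-1)/2}\|_{L^p(w)}\le c\,[w]_{A_p}^{\beta}\qquad\text{for every } w\in A_p.$$ Then $\beta\ge\max\left\{1,\frac1{p-1}\right\}$.
   Context: For $\lambda>0$, the Bochner–Riesz operator $B^\lambda$ on $\mathbb{R}^n$ is $$B^\lambda f(x)=\int_{\mathbb{R}^n}(1-|\xi|^2)_+^\lambda\,\hat f(\xi)\,e^{2\pi i\xi\cdot x}\,d\xi,$$ where $\hat f$ is the Fourier transform of $f$ and $t_+=\max\{t,0\}$. A weight is a non-negative locally integrable function $w$ on $\mathbb{R}^n$. For $1<p<\infty$, $p'$ is defined by $1/p+1/p'=1$, and $w\in A_p$ means $$[w]_{A_p}:=\sup_{Q}\left(\frac1{|Q|}\int_Q w\right)\left(\frac1{|Q|}\int_Q w^{1-p'}\right)^{p-1}<\infty,$$ the supremum being over all cubes $Q\subset\mathbb{R}^n$. $\|f\|_{L^p(w)}=(\int|f|^p w\,dx)^{1/p}$, and $\|T\|_{L^p(w)}$ denotes the operator norm of $T$ on $L^p(w)$. *)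

(* Defs.v *)
From HB Require Import structures.
From mathcomp Require Import all_boot all_order all_algebra.
From mathcomp Require Import all_classical all_reals all_analysis.
From mathcomp Require Import complex.

Set Implicit Arguments.
Unset Strict Implicit.
Unset Printing Implicit Defensive.

Import Order.TTheory GRing.Theory Num.Theory.
Import numFieldNormedType.Exports.

Local Open Scope classical_set_scope.
Local Open Scope ring_scope.

(* R^n is the type of n-tuples, with its product (= Borel) sigma-algebra. *)
Notation euclid R n := (n.-tuple (measurableTypeR R)).

Section lebesgue_cons.
Context (R : realType) (n : nat).
Variable mu : {sigma_finite_measure set (euclid R n) -> \bar R}.

Definition econs (z : measurableTypeR R * euclid R n) : euclid R n.+1 :=
  [tuple of z.1 :: z.2].

Lemma measurable_econs : measurable_fun setT econs.
Proof. by apply: measurable_cons. Qed.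

Definition lebesgue_cons : set (euclid R n.+1) -> \bar R :=
  pushforward ((@lebesgue_measure R) \x mu)%E econs.

Let lebesgue_cons0 : lebesgue_cons set0 = 0%E.
Proof. by rewrite /lebesgue_cons /pushforward preimage_set0 measure0. Qed.

Let lebesgue_cons_ge0 A : (0 <= lebesgue_cons A)%E.
Proof. by rewrite /lebesgue_cons /pushforward measure_ge0. Qed.

Let lebesgue_cons_sigma_additive : semi_sigma_additive lebesgue_cons.
Proof.
move=> F mF tF mUF; rewrite /lebesgue_cons /pushforward preimage_bigcup.
apply: measure_semi_sigma_additive.
- by move=> i; rewrite -[X in measurable X]setTI; exact: measurable_econs.
- apply/trivIsetP => /= i j _ _ ij; rewrite -preimage_setI.
  by move/trivIsetP : tF => /(_ _ _ _ _ ij) ->//; rewrite preimage_set0.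
- by rewrite -preimage_bigcup -[X in measurable X]setTI; exact: measurable_econs.
Qed.

HB.instance Definition _ := isMeasure.Build _ _ _ lebesgue_cons
  lebesgue_cons0 lebesgue_cons_ge0 lebesgue_cons_sigma_additive.

Let lebesgue_cons_sigma_finite : sigma_finite setT lebesgue_cons.
Proof.
pose uncons (x : euclid R n.+1) : measurableTypeR R * euclid R n :=
  (tnth x ord0, [tuple of behead x]).
have muncons : measurable_fun setT uncons.
  apply/measurable_fun_pairP; split => /=.
    exact: measurable_tnth.
  exact: measurable_behead.
have unconsK z : uncons (econs z) = z.
  by case: z => a t; congr pair; apply: val_inj.
have /sigma_finiteP[F [FT ndF Foo]] := sigma_finiteT (@lebesgue_measure R).
have /sigma_finiteP[G [GT ndG Goo]] := sigma_finiteT mu.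
exists (fun k => uncons @^-1` (F k `*` G k)).
  rewrite -preimage_bigcup (_ : \bigcup_k (F k `*` G k) = setT).
    by rewrite preimage_setT.
  rewrite -setXTT FT GT predeqE => -[x y]; split.
    by move=> [k _ []/= ? ?]; split; exists k.
  move=> [/= [i _ Fix] [k _ Gky]]; exists (maxn i k) => //; split.
    by move: x Fix; exact/subsetPset/ndF/leq_maxl.
  by move: y Gky; exact/subsetPset/ndG/leq_maxr.
move=> k; have [mF Fk] := Foo k; have [mG Gk] := Goo k; split.
  by rewrite -[X in measurable X]setTI; apply: muncons => //; exact: measurableX.
rewrite /lebesgue_cons /pushforward -comp_preimage.
rewrite (_ : uncons \o econs = id); last exact/funext.
rewrite preimage_id product_measure1E// lte_mul_pinfty//.
by rewrite ge0_fin_numE.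
Qed.

HB.instance Definition _ := Measure_isSigmaFinite.Build _ _ _ lebesgue_cons
  lebesgue_cons_sigma_finite.

End lebesgue_cons.

(* Lebesgue measure on R^n, as the n-fold product of the one on R *)
Fixpoint lebesgue (R : realType) (n : nat) :
    {sigma_finite_measure set (euclid R n) -> \bar R} :=
  if n is m.+1 then lebesgue_cons (lebesgue R m)
  else \d_([tuple] : euclid R 0).

Section fourier.
Context (R : realType) (n : nat).
Local Notation E := (euclid R n).
Local Notation Re := (@complex.Re R).
Local Notation Im := (@complex.Im R).

Definition edot (x y : E) : R := \sum_(i < n) (tnth x i : R) * (tnth y i : R).

Definition esqnorm (x : E) : R := edot x x.

Definition cabs (z : R[i]) : R := ComplexField.Normc.normc z.

Definition cintegral (f : E -> R[i]) : R[i] :=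
  Complex (\int[lebesgue R n]_x Re (f x))
          (\int[lebesgue R n]_x Im (f x)).

Definition cmeasurable (f : E -> R[i]) : Prop :=
  measurable_fun setT (Re \o f) /\ measurable_fun setT (Im \o f).

Definition cintegrable (f : E -> R[i]) : Prop :=
  cmeasurable f /\ (\int[lebesgue R n]_x (cabs (f x))%:E < +oo)%E.

(* e^(2 pi i t) *)
Definition expi2pi (t : R) : R[i] :=
  Complex (cos (2 * pi * t)) (sin (2 * pi * t)).

Definition fourier (f : E -> R[i]) (xi : E) : R[i] :=
  cintegral (fun x => f x * expi2pi (- edot x xi)).

Definition bochner_riesz (lam : R) (f : E -> R[i]) (x : E) : R[i] :=
  cintegral (fun xi => (Num.max (1 - esqnorm xi) 0 `^ lam)%:C%C *
                       fourier f xi * expi2pi (edot xi x)).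

End fourier.

Section weights.
Context (R : realType) (n : nat).
Local Notation E := (euclid R n).
Local Notation mu := (lebesgue R n).
Local Open Scope ereal_scope.

Definition cube (a : E) (l : R) : set E :=
  [set x | forall i, ((tnth a i : R) <= tnth x i <= (tnth a i : R) + l)%R].

Definition average (Q : set E) (f : E -> \bar R) : \bar R :=
  (fine (mu Q))^-1%:E * \int[mu]_(x in Q) f x.

(* Local integrability is tested on cubes, which is the same as on compacts. *)
Definition weight (w : E -> R) : Prop :=
  [/\ forall x, (0 <= w x)%R,
      measurable_fun setT w &
      forall (a : E) (l : R), (0 < l)%R ->
        \int[mu]_(x in cube a l) (w x)%:E < +oo].

(* p' with 1/p + 1/p' = 1 *)
Definition conjugate_exponent (p : R) : R := (1 - p^-1)^-1.

(* w(x)^(1-p'), which is +oo where w vanishes since 1 - p' < 0; the library's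
   power has 0 `^ r = 0 for every r != 0. *)
Definition dual_weight (p : R) (w : E -> R) (x : E) : \bar R :=
  if w x == 0%R then +oo else (w x `^ (1 - conjugate_exponent p))%:E.

Definition Ap_const (p : R) (w : E -> R) : \bar R :=
  ereal_sup [set q | exists (a : E) (l : R), (0 < l)%R /\
    q = average (cube a l) (EFin \o w) *
        poweR (average (cube a l) (dual_weight p w)) (p - 1)].

Definition Ap (p : R) (w : E -> R) : Prop := weight w /\ Ap_const p w < +oo.

Definition Lpw_norm (p : R) (w : E -> R) (f : E -> R[i]) : \bar R :=
  poweR (\int[mu]_x (cabs (f x) `^ p * w x)%:E) p^-1.

(* Operator norm on L^p(w) of an operator T given on L^1: the supremum is over
   the unit ball of L^1 `&` L^p(w), where the Fourier transform is an absolutely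
   convergent integral and which is dense in L^p(w). *)
Definition Lpw_opnorm (p : R) (w : E -> R)
    (T : (E -> R[i]) -> E -> R[i]) : \bar R :=
  ereal_sup [set Lpw_norm p w (T f) | f in
    [set f | cintegrable f /\ Lpw_norm p w f <= 1]].

End weights.

(* Main.v *)
(* Let K be the convolution kernel of the operator. Rotating the frequency
   variable so that z points along the first axis, and integrating out the other
   coordinates, turns K(z) into a positive multiple of the integral over [-1, 1]
   of (1 - t^2)^(n-1) cos(2 pi |z| t); the exponent is the integer n - 1 exactly
   because the index is (n-1)/2. Integrating by parts twice gives a recursion in
   the exponent, whence K(z) = C |z|^-n (cos(2 pi |z| - n pi/2) + O(1/|z|)) with
   C > 0. Hence, for x in a fixed small box at the origin and y in a fixed
   proportion of the dyadic shell |y| ~ 2^k, K(x - y) >= c 2^(-kn).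

   Let U be a dyadic version of |x|^-n truncated at the scales 2^-M and 2^M. Its
   average over a cube is O(M) times its infimum there, so that [U]_Ap = O(M) and
   [U^(1-p)]_Ap = O(M^(p-1)). Testing the operator on the indicator of the good
   parts of the shells (for the weight U), and on U restricted to the small box
   (for the weight U^(1-p)), shows that both norms are at least c M. Letting M
   tend to infinity gives beta >= 1 and (p - 1) beta >= 1. *)

From HB Require Import structures.
From mathcomp Require Import all_boot all_order all_algebra.
From mathcomp Require Import all_classical all_reals all_analysis.
From mathcomp Require Import measurable_realfun complex ring lra zify.
Require Import Defs.

Set Implicit Arguments.
Unset Strict Implicit.
Unset Printing Implicit Defensive.

Import Order.TTheory GRing.Theory Num.Theory.
Import numFieldNormedType.Exports.

Local Open Scope classical_set_scope.
Local Open Scope ring_scope.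

(** * Integration in the plane *)

(** The index is critical: the kernel is bounded near the origin and decays like [|z|^-n], the
    borderline of integrability at infinity. Growth with M can only come from adding up the shells
    at large scales. The weight needs both ends of its range: with M small and M large scales, it
    gives the small box and the union of the shells masses that are both of order M. In each test
    the [p]-th power of the norm of the image is then at least of order [M^p * M] and that of the
    test function at most of order M, so the quotient of the norms is of order M. The second test
    exchanges the roles of the small box and the shells, which replaces an appeal to duality. The
    obstacle is oscillation: over a whole shell the kernel changes sign. Only those y are kept for
    which the cosine is bounded below. They still fill a fixed proportion of the shell, because
    translates by multiples of 1/4, a quarter of the period of [cos (2 pi r)], cover a box. The box
    for x is so small that moving x changes the phase by at most 1/10. *)

Section one_dimensional_lebesgue.
Context (R : realType).
Local Notation leb := (@lebesgue_measure R).
Local Notation RR := (measurableTypeR R).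
Local Open Scope ereal_scope.

Lemma ge0_integral_image d1 d2 (X : measurableType d1) (Y : measurableType d2)
    (phi : X -> Y) (mu : {measure set X -> \bar R}) (f : Y -> \bar R)
    (mphi : measurable_fun setT phi) :
  measurable_fun setT f -> (forall y, 0 <= f y) ->
  \int[mu]_x f (phi x) = \int[pushforward mu phi]_y f y.
Proof.
move=> mf f0.
have := ge0_integral_pushforward mphi mu measurableT mf (fun x _ => f0 x).
by rewrite preimage_setT => ->.
Qed.

(** The pushforward under a translation agrees with Lebesgue measure on half-open intervals, which
    determine it; the dilations below are handled alike. *)
Lemma ge0_integral_shift (f : RR -> \bar R) (c : R) :
  measurable_fun setT f -> (forall x, 0 <= f x) ->
  \int[leb]_t f (t + c)%R = \int[leb]_t f t.
Proof.
move=> mf f0.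
pose phi : RR -> RR := fun t => (t + c)%R.
have mphi : measurable_fun setT phi by apply: measurable_funD.
rewrite (ge0_integral_image leb mphi mf f0).
apply: eq_measure_integral => //= A mA _; apply/esym.
apply: (@lebesgue_measure_unique R (pushforward leb phi)) => //.
move=> _ [[a b]] _ <-.
have E : phi @^-1` `]a, b]%classic = `](a - c)%R, (b - c)%R]%classic.
  by apply/seteqP; split => t /=; rewrite !in_itv/= ltrBlDr lerBrDr.
transitivity (leb `](a - c)%R, (b - c)%R]%classic); last by rewrite -E.
rewrite !lebesgue_measure_itv/= !lte_fin ltrD2r.
by case: ifP => // _; rewrite -!EFinB; congr EFin; ring.
Qed.

Lemma ge0_integral_opp (f : RR -> \bar R) :
  measurable_fun setT f -> (forall x, 0 <= f x) ->
  \int[leb]_t f (- t)%R = \int[leb]_t f t.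
Proof.
move=> mf f0.
pose phi : RR -> RR := -%R.
have mphi : measurable_fun setT phi by exact: oppr_measurable.
rewrite (ge0_integral_image leb mphi mf f0).
by apply: eq_measure_integral => //= A mA _; exact: lebesgue_measureN.
Qed.

Lemma ge0_integral_scale (f : RR -> \bar R) (s : R) : (0 < s)%R ->
  measurable_fun setT f -> (forall x, 0 <= f x) ->
  s%:E * \int[leb]_t f (s * t)%R = \int[leb]_t f t.
Proof.
move=> s0 mf f0.
pose phi : RR -> RR := fun t => (s * t)%R.
have mphi : measurable_fun setT phi by exact: mulrl_measurable.
pose k := NngNum (ltW s0).
rewrite (ge0_integral_image leb mphi mf f0).
rewrite -(ge0_integral_mscale (pushforward leb phi) measurableT k mf (fun x _ => f0 x)).
apply: eq_measure_integral => //= A mA _; apply/esym.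
apply: (@lebesgue_measure_unique R (mscale k (pushforward leb phi))) => //.
move=> _ [[a b]] _ <-.
have E : phi @^-1` `]a, b]%classic = `](s^-1 * a)%R, (s^-1 * b)%R]%classic.
  by apply/seteqP; split => t /=; rewrite !in_itv/= ltr_pdivrMl// ler_pdivlMl.
transitivity (s%:E * leb `](s^-1 * a)%R, (s^-1 * b)%R]%classic); last by rewrite -E.
rewrite !lebesgue_measure_itv/= !lte_fin ltr_pM2l ?invr_gt0//.
by case: ifP => // _; rewrite ?mule0// -!EFinB -EFinM; congr EFin; field; rewrite gt_eqF.
Qed.

End one_dimensional_lebesgue.

Section plane.
Context (R : realType).
Local Notation leb := (@lebesgue_measure R).
Local Notation RR := (measurableTypeR R).
Local Open Scope ereal_scope.
Implicit Type F : RR * RR -> \bar R.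

Lemma iterated_shear2 F (c : R) : measurable_fun setT F -> (forall z, 0 <= F z) ->
  \int[leb]_t \int[leb]_s F (t, s + c * t)%R = \int[leb]_t \int[leb]_s F (t, s).
Proof.
move=> mF F0; apply: eq_integral => t _.
apply: (ge0_integral_shift (f := fun s => F (t, s))) => //.
by apply: measurableT_comp => //; exact: pair1_measurable.
Qed.

Lemma measurable_shear1 (c : R) :
  measurable_fun setT (fun z : RR * RR => ((z.1 + c * z.2)%R : RR, z.2)).
Proof.
apply: measurable_fun_pair => //.
by apply: (@measurable_funD _ _ R) => //; apply: (@measurable_funM _ _ R).
Qed.

Lemma measurable_shear2 (c : R) :
  measurable_fun setT (fun z : RR * RR => (z.1, (z.2 + c * z.1)%R : RR)).
Proof.
apply: measurable_fun_pair => //.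
by apply: (@measurable_funD _ _ R) => //; apply: (@measurable_funM _ _ R).
Qed.

(** The sheared variable is now the outer one; Tonelli on both sides brings it inside, where the
    shear is a translation. *)
Lemma iterated_shear1 F (c : R) : measurable_fun setT F -> (forall z, 0 <= F z) ->
  \int[leb]_t \int[leb]_s F (t + c * s, s)%R = \int[leb]_t \int[leb]_s F (t, s).
Proof.
move=> mF F0.
pose Fc (z : RR * RR) := F ((z.1 + c * z.2)%R, z.2).
have mFc : measurable_fun setT Fc := measurableT_comp mF (measurable_shear1 c).
rewrite (fubini_tonelli F mF F0) (fubini_tonelli Fc mFc (fun z => F0 _)).
apply: eq_integral => s _; rewrite /fubini_G /Fc /=.
apply: (ge0_integral_shift (f := fun t => F (t, s))) => [|x]; last exact: F0.
by apply: measurableT_comp => //; exact: pair2_measurable.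
Qed.

(* A rotation is a product of three shears, each of which is a translation on
   lines. *)
Lemma iterated_rotation F (c d : R) : (c ^+ 2 + d ^+ 2 = 1)%R -> (c != -1)%R ->
  measurable_fun setT F -> (forall z, 0 <= F z) ->
  \int[leb]_t \int[leb]_s F (c * t + d * s, c * s - d * t)%R
  = \int[leb]_t \int[leb]_s F (t, s).
Proof.
move=> cd cN mF F0.
have c1 : (1 + c != 0)%R by rewrite addrC addr_eq0.
(* For [c] and [d] the cosine and sine of an angle, [u] is the tangent of its half; the shears are
   by [u], [- d], [u]. At the angle pi this tangent is infinite. *)
pose u := (d / (1 + c))%R.
pose F1 (z : RR * RR) := F (z.1 + u * z.2, z.2)%R.
have mF1 : measurable_fun setT F1.
  by apply: measurableT_comp => //; exact: measurable_shear1.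
pose F2 (z : RR * RR) := F1 (z.1, z.2 - d * z.1)%R.
have mF2 : measurable_fun setT F2.
  apply: (measurableT_comp mF1).
  have := measurable_shear2 (- d)%R.
  by under eq_fun do rewrite mulNr.
rewrite -(iterated_shear1 u mF F0).
rewrite -(iterated_shear2 (- d)%R mF1 (fun z => F0 _)).
have <- : \int[leb]_t \int[leb]_s F2 (t + u * s, s)%R =
   \int[leb]_t \int[leb]_s F1 (t, s + - d * t)%R.
  rewrite (iterated_shear1 u mF2 (fun z => F0 _)).
  by apply: eq_integral => t _; apply: eq_integral => s _; rewrite /F2/= mulNr.
apply: eq_integral => t _; apply: eq_integral => s _; rewrite /F2/F1/=.
have E1 : (c = 1 - d * u)%R.
  have -> : (1 - d * u = (1 + c - d ^+ 2) / (1 + c))%R by rewrite /u; field.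
  have -> : (d ^+ 2 = 1 - c ^+ 2)%R by rewrite -cd; ring.
  by field.
have E2 : (d = u * (1 + c))%R by rewrite /u; field.
congr (F (_, _)); last by rewrite {1}E1; ring.
transitivity ((1 - d * u) * t + (u * (1 + c)) * s)%R; first by rewrite -E1 -E2.
by rewrite E1; ring.
Qed.

Lemma iterated_opp1 F : measurable_fun setT F -> (forall z, 0 <= F z) ->
  \int[leb]_t \int[leb]_s F (- t, s)%R = \int[leb]_t \int[leb]_s F (t, s).
Proof.
move=> mF F0.
apply: (ge0_integral_opp (f := fun t => \int[leb]_s F (t, s))).
  exact: (measurable_fun_fubini_tonelli_F F).
by move=> t; exact: integral_ge0.
Qed.

(* The rotation by pi, which is not a product of three shears, only occurs for
   [b = 0] since [0 <= b]; it is replaced by a reflection. *)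
Lemma iterated_radial (G : RR * RR -> \bar R) (q a b : R) : (0 <= b)%R ->
  measurable_fun setT G -> (forall z, 0 <= G z) ->
  \int[leb]_t \int[leb]_s G (q + t ^+ 2 + s ^+ 2, t * a + s * b)%R =
  \int[leb]_t \int[leb]_s G (q + t ^+ 2 + s ^+ 2, t * Num.sqrt (a ^+ 2 + b ^+ 2))%R.
Proof.
move=> b0 mG G0; set r := Num.sqrt _.
have r2 : (r ^+ 2 = a ^+ 2 + b ^+ 2)%R by rewrite sqr_sqrtr// addr_ge0// sqr_ge0.
have r0 : (0 <= r)%R by exact: sqrtr_ge0.
pose F (z : RR * RR) := G (q + z.1 ^+ 2 + z.2 ^+ 2, z.1 * r)%R.
have mF : measurable_fun setT F.
  apply: (measurableT_comp mG); apply/measurable_fun_pairP; split => /=.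
    by repeat apply: measurable_funD => //; apply: measurable_funX.
  by apply: measurable_funM.
have [rz|rN0] := eqVneq r 0%R.
  have [-> ->] : a = 0%R /\ b = 0%R by move: r2; rewrite rz; split; nra.
  by apply: eq_integral => t _; apply: eq_integral => s _; rewrite rz !mulr0 addr0.
have [aN|aN] := eqVneq a (- r)%R.
  have bz : (b = 0)%R.
    by move/eqP: r2; rewrite aN sqrrN -subr_eq0 opprD addrA subrr sub0r oppr_eq0 sqrf_eq0 => /eqP.
  rewrite -(iterated_opp1 mF (fun z => G0 _)).
  apply: eq_integral => t _; apply: eq_integral => s _; rewrite /F/=.
  by rewrite bz mulr0 addr0 sqrrN aN mulrN mulNr.
have ab1 : ((a / r) ^+ 2 + (b / r) ^+ 2 = 1)%R.
  by rewrite !expr_div_n -mulrDl -r2 divff// expf_neq0.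
have arN1 : (a / r != -1)%R.
  apply/eqP => /(congr1 ( *%R^~ r)%R); rewrite -mulrA mulVf// mulr1 mulN1r => E.
  by rewrite E eqxx in aN.
rewrite -(iterated_rotation ab1 arN1 mF (fun z => G0 _)).
apply: eq_integral => t _; apply: eq_integral => s _; rewrite /F/=; congr (G (_, _)).
  rewrite -!addrA; congr (_ + _)%R.
  transitivity ((t ^+ 2 + s ^+ 2) * ((a ^+ 2 + b ^+ 2) / r ^+ 2))%R; last by field.
  by rewrite -r2 divff ?mulr1// expf_neq0.
by field.
Qed.

End plane.

(** * Radial integrals *)

Section euclid_integral.
Context (R : realType).
Local Notation leb := (@lebesgue_measure R).
Local Notation RR := (measurableTypeR R).
Local Notation E n := (euclid R n).

Lemma tnth_econs0 n (t : RR) (x : E n) : tnth (econs (t, x)) ord0 = t.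
Proof. by []. Qed.

Lemma tnth_econsS n (t : RR) (x : E n) i :
  tnth (econs (t, x)) (lift ord0 i) = tnth x i.
Proof. by rewrite (tnth_nth t) /= -(tnth_nth t). Qed.

Lemma econsP n (z : E n.+1) : exists t x, z = econs (t, x).
Proof. by case/tupleP: z => t x; exists t, x; apply: val_inj. Qed.

Lemma edot_econs n (t s : RR) (x y : E n) :
  edot (econs (t, x)) (econs (s, y)) = t * s + edot x y.
Proof.
rewrite /edot big_ord_recl /= !tnth_econs0; congr (_ + _).
by apply: eq_bigr => i _; rewrite !tnth_econsS.
Qed.

Lemma esqnorm_econs n (t : RR) (x : E n) :
  esqnorm (econs (t, x)) = t ^+ 2 + esqnorm x.
Proof. by rewrite /esqnorm edot_econs. Qed.

Lemma esqnorm_ge0 n (x : E n) : 0 <= esqnorm x.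
Proof. by apply: sumr_ge0 => i _; rewrite -expr2 sqr_ge0. Qed.

Lemma measurable_coord n (i : 'I_n) :
  measurable_fun setT (fun x : E n => tnth x i : R).
Proof. exact: measurable_tnth. Qed.

Lemma measurable_edot d (T : measurableType d) n (f g : T -> E n) :
  measurable_fun setT f -> measurable_fun setT g ->
  measurable_fun setT (fun x => edot (f x) (g x)).
Proof.
move=> mf mg; apply: measurable_sum => i; apply: measurable_funM.
  exact: (measurableT_comp (measurable_coord i) mf).
exact: (measurableT_comp (measurable_coord i) mg).
Qed.

Lemma measurable_esqnorm n : measurable_fun setT (@esqnorm R n).
Proof. exact: measurable_edot. Qed.

Local Open Scope ereal_scope.

Lemma lebesgueSE n (f : E n.+1 -> \bar R) :
  measurable_fun setT f -> (forall x, 0 <= f x) ->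
  \int[lebesgue R n.+1]_x f x =
  \int[leb]_t \int[lebesgue R n]_x f (econs (t, x)).
Proof.
move=> mf f0.
have mfc : measurable_fun setT (f \o @econs R n).
  exact: (measurableT_comp mf (@measurable_econs R n)).
rewrite -[RHS](fubini_tonelli1 (f \o @econs R n) mfc (fun z => f0 _)).
by rewrite (ge0_integral_image _ (@measurable_econs R n) mf f0).
Qed.

Lemma integral_lebesgue0 (f : E 0 -> \bar R) :
  \int[lebesgue R 0]_x f x = f [tuple].
Proof.
have -> : f = cst (f [tuple]) by apply/funext => x; rewrite tuple0.
by rewrite /= integral_cst//= diracT mule1.
Qed.

Lemma measurable_lebesgue_param d (T : measurableType d) n (f : T * E n -> \bar R) :
  measurable_fun setT f -> (forall x, 0 <= f x) ->
  measurable_fun setT (fun z => \int[lebesgue R n]_x f (z, x)).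
Proof. exact: measurable_fun_fubini_tonelli_F. Qed.

Lemma measurable_radial n (G : RR * RR -> \bar R) (z : E n) : measurable_fun setT G ->
  measurable_fun setT (fun x : E n => G (esqnorm x, edot x z)).
Proof.
move=> mG; apply: (measurableT_comp mG); apply: measurable_fun_pair.
  exact: measurable_esqnorm.
by apply: measurable_edot; [exact: measurable_id|exact: measurable_cst].
Qed.

(** Induction on the dimension: the induction hypothesis turns the tail [y] of [z] onto one axis,
    where only its norm [b] is left, and a rotation of the plane of the first two axes then merges
    [a] and [b] into the norm of [z]. *)
Lemma integral_radial n (z : E n.+1) (G : RR * RR -> \bar R) :
  measurable_fun setT G -> (forall u, 0 <= G u) ->
  \int[lebesgue R n.+1]_x G (esqnorm x, edot x z) =
  \int[leb]_t \int[lebesgue R n]_x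
     G (t ^+ 2 + esqnorm x, t * Num.sqrt (esqnorm z))%R.
Proof.
elim: n z G => [|n IH] z G mG G0.
  have [a [y ->]] := econsP z.
  rewrite (lebesgueSE (measurable_radial _ mG) (fun x => G0 _)).
  have e0 : edot y y = 0%R by rewrite /edot big_ord0.
  under eq_integral do rewrite integral_lebesgue0 edot_econs esqnorm_econs /edot big_ord0 addr0.
  under [RHS]eq_integral do rewrite integral_lebesgue0 esqnorm_econs {2}/esqnorm e0 addr0 sqrtr_sqr.
  pose F t := G (t ^+ 2 + esqnorm ([tuple] : E 0), t * `|a|)%R.
  have mF : measurable_fun setT F.
    apply: (measurableT_comp mG); apply: measurable_fun_pair.
      by apply: (@measurable_funD _ _ R) => //; exact: exprn_measurable.
    exact: mulrr_measurable.
  have [a0|a0] := leP 0%R a; first by rewrite ger0_norm.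
  rewrite -(ge0_integral_opp mF (fun t => G0 _)); apply: eq_integral => t _.
  by rewrite /F sqrrN ltr0_norm// mulrNN.
have [a [y ->]] := econsP z.
rewrite (lebesgueSE (measurable_radial _ mG) (fun x => G0 _)).
pose b := Num.sqrt (esqnorm y).
pose H (u : RR * RR) := \int[lebesgue R n]_x G (u.1 + esqnorm x, u.2)%R.
have mGG : measurable_fun setT (fun v : (RR * RR) * E n => G (v.1.1 + esqnorm v.2, v.1.2)%R).
  apply: (measurableT_comp mG); apply: measurable_fun_pair.
    apply: (@measurable_funD _ _ R).
      exact: (measurableT_comp measurable_fst measurable_fst).
    exact: (measurableT_comp (@measurable_esqnorm n) measurable_snd).
  exact: (measurableT_comp measurable_snd measurable_fst).
have mH : measurable_fun setT H.
  exact: (measurable_lebesgue_param mGG (fun v => G0 _)).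
have H0 u : 0 <= H u by apply: integral_ge0 => x _; exact: G0.
transitivity (\int[leb]_t \int[leb]_s H (0 + t ^+ 2 + s ^+ 2, t * a + s * b)%R).
  apply: eq_integral => t _.
  under eq_integral do rewrite edot_econs esqnorm_econs.
  pose Gt (u : RR * RR) := G (t ^+ 2 + u.1, t * a + u.2)%R.
  have mGt : measurable_fun setT Gt.
    apply: (measurableT_comp mG); apply: measurable_fun_pair;
      by apply: (@measurable_funD _ _ R).
  rewrite (IH y Gt mGt (fun u => G0 _)).
  apply: eq_integral => s _; apply: eq_integral => x _.
  by rewrite /Gt/= add0r addrA.
rewrite (iterated_radial _ _ _ mH H0) ?sqrtr_ge0//.
apply: eq_integral => t _.
rewrite esqnorm_econs -[in RHS](sqr_sqrtr (esqnorm_ge0 y)) -/b.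
set w := (t * _)%R.
have mGw : measurable_fun setT (fun x : E n.+1 => G (t ^+ 2 + esqnorm x, w)%R).
  apply: (measurableT_comp mG); apply: measurable_fun_pair; last exact: measurable_cst.
  by apply: measurable_funD; [exact: measurable_cst|exact: measurable_esqnorm].
rewrite (lebesgueSE mGw (fun x => G0 _)) /w.
apply: eq_integral => s _; apply: eq_integral => x _.
by rewrite /= !esqnorm_econs add0r addrA.
Qed.

End euclid_integral.

(** * Integrals of powers of 1 - |x|^2 *)

Section radial_profile.
Context (R : realType).
Local Notation leb := (@lebesgue_measure R).
Local Notation RR := (measurableTypeR R).
Local Notation E n := (euclid R n).

Definition pospow (mu s : R) : R := Num.max s 0 `^ mu.

Lemma pospow_ge0 mu s : 0 <= pospow mu s.
Proof. exact: powR_ge0. Qed.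

Lemma pospow_le0 mu s : 0 < mu -> s <= 0 -> pospow mu s = 0.
Proof. by move=> mu0 s0; rewrite /pospow max_r// powR0// gt_eqF. Qed.

Lemma pospow_ge0E mu s : 0 <= s -> pospow mu s = s `^ mu.
Proof. by move=> s0; rewrite /pospow max_l. Qed.

Lemma pospowM mu s t : 0 < s -> pospow mu (s * t) = s `^ mu * pospow mu t.
Proof.
move=> s0; rewrite /pospow -powRM ?(ltW s0)//; last by rewrite le_max lexx orbT.
by rewrite maxr_pMr ?(ltW s0)// mulr0.
Qed.

Lemma pospow_le1 mu s : 0 <= mu -> s <= 1 -> pospow mu s <= 1.
Proof.
move=> mu0 s1; have <- : (1 : R) `^ mu = 1 by rewrite powR1.
apply: ge0_ler_powR => //.
- by rewrite nnegrE le_max lexx orbT.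
- by rewrite nnegrE.
- by rewrite ge_max s1 ler01.
Qed.

Lemma measurable_pospow mu : measurable_fun setT (pospow mu).
Proof.
apply: (measurableT_comp (@measurable_powR R mu)).
exact: measurable_maxr.
Qed.

Local Open Scope ereal_scope.

(** The exact value is a Beta integral; a constant bound on [[-1, 1]] and the part over [[0, 1/2]]
    already show that it is finite and positive. *)
Lemma integral_pospow1 (mu : R) : (0 < mu)%R -> exists W : R, (0 < W)%R /\
  \int[leb]_t (pospow mu (1 - t ^+ 2))%:E = W%:E.
Proof.
move=> mu0.
have mf : measurable_fun setT (fun t : RR => pospow mu (1 - t ^+ 2)).
  apply: (measurableT_comp (measurable_pospow mu)).
  by apply: measurable_funB => //; exact: exprn_measurable.
have ub : \int[leb]_t (pospow mu (1 - t ^+ 2))%:E <= 2%:E.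
  have -> : 2%:E = \int[leb]_(t in `[(-1)%R, 1%R]) (cst 1 t).
    rewrite integral_cst// mul1e.
    suff L : leb `[(-1)%R, 1%R]%classic = 2%:E by exact/esym/L.
    have h : (-1 < 1 :> R)%R by lra.
    by rewrite lebesgue_measure_itv/= lte_fin h -EFinB opprK.
  rewrite [leRHS]integral_mkcond; apply: ge0_le_integral => //.
  - by move=> t _; rewrite lee_fin pospow_ge0.
  - exact/measurable_EFinP.
  - by apply/(measurable_restrictT _ _).1 => //.
  - move=> t _; rewrite patchE; case: ifPn => [_|].
      by rewrite lee_fin pospow_le1 ?(ltW mu0)// gerBl sqr_ge0.
    rewrite notin_setE/= in_itv/= => tN.
    rewrite pospow_le0// leNgt; apply/negP => t2; apply: tN.
    by apply/andP; split; nra.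
have lb : (2^-1 * (1/2) `^ mu)%:E <= \int[leb]_t (pospow mu (1 - t ^+ 2))%:E.
  have -> : (2^-1 * (1/2) `^ mu)%:E = \int[leb]_(t in `[0%R, 2^-1%R]) (cst ((1/2) `^ mu)%:E t).
    rewrite integral_cst// muleC EFinM; congr (_ * _).
    suff L : leb `[0%R, 2^-1%R]%classic = 2^-1%:E by exact/esym/L.
    by rewrite lebesgue_measure_itv/= lte_fin invr_gt0 ltr0n sube0.
  rewrite [leLHS]integral_mkcond; apply: ge0_le_integral => //.
  - by move=> t _; apply: erestrict_ge0 => ? _; rewrite lee_fin powR_ge0.
  - by apply/(measurable_restrictT _ _).1 => //.
  - exact/measurable_EFinP.
  - move=> t _; rewrite patchE; case: ifPn => [|_]; last by rewrite lee_fin pospow_ge0.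
    rewrite inE/= in_itv/= => /andP[t0 t1]; rewrite lee_fin.
    have h : (1 / 2 <= 1 - t ^+ 2)%R by nra.
    have h0 : (0 <= 1 - t ^+ 2)%R by nra.
    rewrite pospow_ge0E//; apply: ge0_ler_powR; rewrite ?nnegrE//; first exact: ltW.
have fin : \int[leb]_t (pospow mu (1 - t ^+ 2))%:E \is a fin_num.
  rewrite ge0_fin_numE; first by rewrite (le_lt_trans ub)// ltry.
  by apply: integral_ge0 => t _; rewrite lee_fin pospow_ge0.
pose W := fine (\int[leb]_t (pospow mu (1 - t ^+ 2))%:E).
exists W; split; last by rewrite fineK.
rewrite -lte_fin /W fineK//; apply: lt_le_trans lb.
by rewrite lte_fin mulr_gt0// powR_gt0.
Qed.

(** Each coordinate raises the exponent by 1/2: in [(s - t^2)^mu] the substitution [t -> sqrt s * t]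
    pulls out [s^mu], and its Jacobian is [sqrt s]. *)
Lemma integral_pospow (lam : R) n : (0 < lam)%R -> exists C : R, (0 < C)%R /\
  forall s, \int[lebesgue R n]_x (pospow lam (s - esqnorm x))%:E =
    (C * pospow (lam + n%:R / 2) s)%:E.
Proof.
move=> lam0; elim: n => [|n [C [C0 IH]]].
  exists 1%R; split=> // s.
  by rewrite integral_lebesgue0 /esqnorm /edot big_ord0 subr0 mul1r mul0r addr0.
pose mu := (lam + n%:R / 2)%R.
have mu0 : (0 < mu)%R by rewrite /mu ltr_wpDr// divr_ge0.
have [W [W0 HW]] := integral_pospow1 mu0.
exists (C * W)%R; split; first exact: mulr_gt0.
have -> : (lam + n.+1%:R / 2 = mu + 2^-1)%R by rewrite /mu -natr1; field.
move=> s.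
have mpos : measurable_fun setT (fun x : E n.+1 => (pospow lam (s - esqnorm x))%:E).
  apply/measurable_EFinP; apply: (measurableT_comp (measurable_pospow lam)).
  by apply: measurable_funB => //; exact: measurable_esqnorm.
rewrite (lebesgueSE mpos) => [|x]; last by rewrite lee_fin pospow_ge0.
transitivity (\int[leb]_t (C * pospow mu (s - t ^+ 2))%:E).
  apply: eq_integral => t _; rewrite -IH; apply: eq_integral => x _.
  by rewrite esqnorm_econs opprD addrA.
have [s0|s0] := leP s 0%R.
  rewrite pospow_le0 ?mulr0; last 2 first.
  - by rewrite ltr_wpDr.
  - by [].
  rewrite (_ : (fun t => _) = cst 0) ?integral0//.
  apply/funext => t; rewrite pospow_le0 ?mulr0//.
  by rewrite subr_le0 (le_trans s0)// sqr_ge0.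
have rs0 : (0 < Num.sqrt s)%R by rewrite sqrtr_gt0.
pose f (t : RR) := (C * pospow mu (s - t ^+ 2))%:E.
have mf : measurable_fun setT f.
  apply/measurable_EFinP; apply: measurable_funM => //.
  apply: (measurableT_comp (measurable_pospow mu)).
  by apply: measurable_funB => //; exact: exprn_measurable.
have f0 t : 0 <= f t by rewrite lee_fin mulr_ge0 ?pospow_ge0// ltW.
rewrite -(ge0_integral_scale rs0 mf f0).
have K0 : (0 <= C * s `^ mu)%R by rewrite mulr_ge0 ?powR_ge0// ltW.
transitivity ((Num.sqrt s)%:E * \int[leb]_t ((C * s `^ mu)%:E * (pospow mu (1 - t ^+ 2))%:E)).
  congr (_ * _); apply: eq_integral => t _; rewrite /f -EFinM; congr EFin.
  rewrite -mulrA -pospowM//; congr (_ * pospow mu _)%R.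
  by rewrite exprMn sqr_sqrtr ?(ltW s0)//; ring.
rewrite ge0_integralZl//; last 2 first.
- apply/measurable_EFinP; apply: (measurableT_comp (measurable_pospow mu)).
  by apply: measurable_funB => //; exact: exprn_measurable.
- by move=> t _; rewrite lee_fin pospow_ge0.
rewrite HW -!EFinM; congr EFin.
rewrite pospow_ge0E ?(ltW s0)// powRD; last by rewrite (gt_eqF s0) implybT.
by rewrite powR12_sqrt ?(ltW s0)//; ring.
Qed.

(** The [n] coordinates orthogonal to [z] raise the exponent [n / 2] by another [n / 2], which makes
    it an integer. [h] is non-negative so that Tonelli applies. *)
Lemma integral_bochner_riesz_profile n : (0 < n)%N -> exists C : R, (0 < C)%R /\
  forall (z : E n.+1) (h : R -> R), measurable_fun setT h -> (forall t, 0 <= h t)%R ->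
  \int[lebesgue R n.+1]_x (pospow (n%:R / 2) (1 - esqnorm x) * h (edot x z))%:E =
  C%:E * \int[leb]_t (pospow n%:R (1 - t ^+ 2) * h (t * Num.sqrt (esqnorm z)))%:E.
Proof.
move=> n0.
have lam0 : (0 < n%:R / 2 :> R)%R by rewrite divr_gt0// ltr0n.
have [C [C0 HC]] := integral_pospow n lam0.
have nE : (n%:R / 2 + n%:R / 2 = n%:R :> R)%R by field.
rewrite nE in HC.
exists C; split => // z h mh h0.
pose G (u : RR * RR) := (pospow (n%:R / 2) (1 - u.1) * h u.2)%:E.
have mG : measurable_fun setT G.
  apply/measurable_EFinP; apply: measurable_funM.
    apply: (measurableT_comp (measurable_pospow _)).
    by apply: measurable_funB.
  exact: (measurableT_comp mh measurable_snd).
have G0 u : 0 <= G u by rewrite lee_fin mulr_ge0 ?pospow_ge0.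
rewrite (integral_radial z mG G0) -ge0_integralZl_EFin//; last 3 first.
- by move=> t _; rewrite lee_fin mulr_ge0 ?pospow_ge0.
- apply/measurable_EFinP; apply: measurable_funM.
    apply: (measurableT_comp (measurable_pospow _)).
    by apply: measurable_funB => //; exact: exprn_measurable.
  by apply: (measurableT_comp mh); exact: mulrr_measurable.
- exact: ltW.
apply: eq_integral => t _; rewrite /G/=.
under eq_integral do rewrite mulrC EFinM opprD addrA.
rewrite ge0_integralZl_EFin//; last 2 first.
- by move=> x _; rewrite lee_fin pospow_ge0.
- apply/measurable_EFinP; apply: (measurableT_comp (measurable_pospow _)).
  by apply: measurable_funB => //; exact: measurable_esqnorm.
by rewrite HC -!EFinM; congr EFin; ring.
Qed.

End radial_profile.

(** * The oscillatory integral *)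

Section oscillatory_integral.
Context (R : realType).
Local Notation leb := (@lebesgue_measure R).
Local Notation RR := (measurableTypeR R).
Implicit Types (a t : R) (N : nat).

Definition oscf N a t : R := (1 - t ^+ 2) ^+ N * cos (a * t).

(** Poisson's integral: up to a constant factor, [J_(N+1/2)(a) / a^(N+1/2)]. Bessel functions of
    half-integer order are elementary, so a recursion starting from sines and cosines gives the
    asymptotics. *)
Definition osc N a : R := \int[leb]_(t in `[(-1)%R, 1%R]) oscf N a t.

Let q : R -> R := cst 1 - id ^+ 2.
Let sn a : R -> R := sin \o (a *: id).
Let cs a : R -> R := cos \o (a *: id).

Let is_derive_q t : is_derive t 1 q (- (2 * t)).
Proof. by apply: is_derive_eq; rewrite /= !scaler1 sub0r expr1 mulr_natl. Qed.

Let is_derive_sn a t : is_derive t 1 (sn a) (a * cos (a * t)).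
Proof. by apply: is_derive_eq; rewrite scaler1 mulrC. Qed.

Let is_derive_cs a t : is_derive t 1 (cs a) (- (a * sin (a * t))).
Proof. by apply: is_derive_eq; rewrite scaler1 mulNr mulrC. Qed.

Let oscfE N a : oscf N a = q ^+ N * cs a.
Proof.
apply/funext => t; rewrite /oscf /q /cs !fctE.
by elim: N => [|N IH]; rewrite ?expr0// !exprS -!mulrA IH mulrA.
Qed.

Lemma continuous_oscf N a : continuous (oscf N a).
Proof.
move=> t; apply: differentiable_continuous; apply/derivable1_diffP.
rewrite oscfE; case: N => [|N]; last exact: ex_derive.
by rewrite expr0 mul1r; exact: ex_derive.
Qed.

Lemma integrable_oscf N a :
  leb.-integrable `[(-1)%R, 1%R] (EFin \o oscf N a).
Proof.
apply: continuous_compact_integrable; first exact: segment_compact.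
by apply: continuous_subspaceT; exact: continuous_oscf.
Qed.

Lemma integrable_Zoscf k N a :
  leb.-integrable `[(-1)%R, 1%R] (EFin \o (fun t => k * oscf N a t)).
Proof. exact: (integrableZl _ k (integrable_oscf N a)). Qed.

Lemma RintegralZl_oscf k N a :
  \int[leb]_(t in `[(-1)%R, 1%R]) (k * oscf N a t) = k * osc N a.
Proof. by rewrite RintegralZl//; exact: integrable_oscf. Qed.

Lemma Rintegral_derivative (f F : R -> R) : continuous f ->
  (forall t, is_derive t 1 F (f t)) ->
  \int[leb]_(t in `[(-1)%R, 1%R]) f t = F 1 - F (-1).
Proof.
move=> cf dF; have N11 : -1 < 1 :> R by lra.
rewrite /Rintegral (continuous_FTC2 (F := F) N11)//.
- exact: continuous_subspaceT.
- have cF : continuous F.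
    by move=> t; apply/differentiable_continuous/derivable1_diffP; exact: ex_derive.
  split.
  + by move=> t _; exact: ex_derive.
  + exact/cvg_at_right_filter/cF.
  + exact/cvg_at_left_filter/cF.
- by move=> t _; rewrite derive1E derive_val.
Qed.

Lemma osc0E a : a * osc 0 a = 2 * sin a.
Proof.
rewrite /osc -RintegralZl//; last exact: integrable_oscf.
have cf : continuous (fun t => a * oscf 0 a t).
  by move=> t; apply: cvgM; [exact: cvg_cst|exact: continuous_oscf].
have dF t : is_derive t 1 (sn a) (a * oscf 0 a t).
  by rewrite /oscf expr0 mul1r; exact: is_derive_sn.
rewrite (Rintegral_derivative cf dF).
have snE t : sn a t = sin (a * t) by [].
by rewrite !snE mulr1 mulrN1 sinN; ring.
Qed.

Lemma osc1E a : a ^+ 2 * osc 1 a = 2 * osc 0 a - 4 * cos a.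
Proof.
have -> : - (4 * cos a) =
  \int[leb]_(t in `[(-1)%R, 1%R]) (a ^+ 2 * oscf 1 a t - 2 * oscf 0 a t).
  have cf : continuous (fun t => a ^+ 2 * oscf 1 a t - 2 * oscf 0 a t).
    by move=> t; apply: cvgB; apply: cvgM; try exact: cvg_cst; exact: continuous_oscf.
  (* Both integrations by parts in one antiderivative. [q] vanishes at the end points but the second
     summand survives there, whence the term [4 * cos a]. *)
  have dF t : is_derive t 1 (a *: (q * sn a) - (2 : R) *: (id * cs a))
      (a ^+ 2 * oscf 1 a t - 2 * oscf 0 a t).
    apply: is_derive_eq.
    rewrite /oscf /q /cs /sn !fctE /GRing.scale/=.
    by ring.
  rewrite (Rintegral_derivative cf dF).
  rewrite !fctE /sn /cs /q /= !fctE /GRing.scale/= !mulr1 !mulrN1 cosN.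
  by ring.
rewrite (RintegralB _ (integrable_Zoscf _ _ _) (integrable_Zoscf _ _ _))//.
by rewrite !RintegralZl_oscf; ring.
Qed.

(** The boundary terms contain a positive power of [1 - t^2] and vanish. The second integration by
    parts leaves a factor [t^2], which is written as [1 - (1 - t^2)] and so splits into the two
    lower exponents. *)
Lemma oscSS N a : a ^+ 2 * osc N.+2 a =
  2 * N.+2%:R * (2 * N%:R + 3) * osc N.+1 a - 4 * N.+2%:R * N.+1%:R * osc N a.
Proof.
set c1 := 2 * N.+2%:R * _; set c2 := 4 * _ * _.
have : \int[leb]_(t in `[(-1)%R, 1%R])
   (a ^+ 2 * oscf N.+2 a t - (c1 * oscf N.+1 a t - c2 * oscf N a t)) = 0.
  have cf : continuous (fun t => a ^+ 2 * oscf N.+2 a t -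
      (c1 * oscf N.+1 a t - c2 * oscf N a t)).
    move=> t; apply: cvgB.
      by apply: cvgM; [exact: cvg_cst|exact: continuous_oscf].
    by apply: cvgB; apply: cvgM; try exact: cvg_cst; exact: continuous_oscf.
  have dF t : is_derive t 1
      (a *: (q ^+ N.+2 * sn a) - (2 * N.+2%:R : R) *: (id * q ^+ N.+1 * cs a))
      (a ^+ 2 * oscf N.+2 a t - (c1 * oscf N.+1 a t - c2 * oscf N a t)).
    apply: is_derive_eq.
    rewrite !oscfE /c1 /c2 !exprS !fctE /GRing.scale/=.
    rewrite -/(cs a t) -/(sn a t).
    have -> : cos (a * t) = cs a t by [].
    have -> : sin (a * t) = sn a t by [].
    set Q := q t ^+ N.
    have -> : q t = 1 - t * t by rewrite /q !fctE.
    by rewrite expr0 -!natr1; ring.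
  rewrite (Rintegral_derivative cf dF).
  have q1 : q 1 = 0 by rewrite /q !fctE expr1n subrr.
  have qN1 : q (-1) = 0 by rewrite /q !fctE sqrrN expr1n subrr.
  by rewrite !fctE !exprS q1 qN1 !(mul0r, mulr0, scaler0) !subr0.
have i2 : leb.-integrable `[(-1)%R, 1%R]
    (EFin \o (fun t => c1 * oscf N.+1 a t - c2 * oscf N a t)).
  apply: (integrableB _ (integrable_Zoscf c1 N.+1 a) (integrable_Zoscf c2 N a)).
  exact: measurable_itv.
rewrite (RintegralB _ (integrable_Zoscf _ _ _) i2)//.
rewrite (RintegralB _ (integrable_Zoscf _ _ _) (integrable_Zoscf _ _ _))//.
by rewrite !RintegralZl_oscf => /eqP; rewrite subr_eq0 => /eqP.
Qed.

(** In the recursion the summand with [osc N] carries the main term: its coefficient is the quotient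
    of the leading constants, and its sign is the phase shift by pi between [N] and [N.+2]. The
    summand with [osc N.+1] is smaller by one power of [a] and joins the error, so the induction
    runs over two consecutive indices. *)
Lemma osc_asymptotic N : exists K : R, 0 <= K /\ forall a, 1 <= a ->
  `|osc N a - 2 ^+ N.+1 * N`!%:R * cos (a - N.+1%:R * (pi / 2)) * a^-1 ^+ N.+1|
    <= K * a^-1 ^+ N.+2.
Proof.
pose D N : R := 2 ^+ N.+1 * N`!%:R.
pose c N a := cos (a - N.+1%:R * (pi / 2)) : R.
pose P N := exists K : R, 0 <= K /\ forall a, 1 <= a ->
  `|osc N a - D N * c N a * a^-1 ^+ N.+1| <= K * a^-1 ^+ N.+2.
suff [] : P N /\ P N.+1 by [].
have D0 M : 0 <= D M by rewrite mulr_ge0// exprn_ge0.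
have c0 a : c 0%N a = sin a by rewrite /c mul1r cosBpihalf.
have cS M a : c M.+2 a = - c M a.
  rewrite /c (_ : a - M.+3%:R * (pi / 2) = a - M.+1%:R * (pi / 2) - pi).
    by rewrite cosB sinpi cospi mulr0 addr0 mulrN1.
  by rewrite -!natr1; field.
have c1 a : c 1%N a = - cos a.
  rewrite /c (_ : a - 2%:R * (pi / 2) = a - pi); last by field.
  by rewrite cosB sinpi cospi mulr0 addr0 mulrN1.
have P0 : P 0%N.
  exists 0; split=> // a a1; have a0 : a != 0 by rewrite gt_eqF// (lt_le_trans ltr01).
  have -> : osc 0 a = 2 * sin a * a^-1 by rewrite -osc0E mulrAC divff// mul1r.
  by rewrite c0 /D fact0 mulr1 !expr1 subrr normr0 mul0r.
elim: N => [|N [[K [K0 HK]] [K' [K'0 HK']]]].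
  split=> //; exists 4; split=> // a a1.
  have a0 : a != 0 by rewrite gt_eqF// (lt_le_trans ltr01).
  have ai0 : 0 <= a^-1 by rewrite invr_ge0 (le_trans ler01).
  have -> : osc 1 a = (2 * (2 * sin a * a^-1) - 4 * cos a) * a^-1 ^+ 2.
    have <- : osc 0 a = 2 * sin a * a^-1 by rewrite -osc0E mulrAC divff// mul1r.
    by rewrite -osc1E; field.
  rewrite c1 /D (_ : 1`! = 1)%N// mulr1.
  rewrite (_ : _ - _ = 4 * a^-1 ^+ 3 * sin a); last by rewrite !exprS expr0; ring.
  rewrite normrM ger0_norm ?mulr_ge0 ?exprn_ge0//.
  by rewrite ler_piMr ?mulr_ge0 ?exprn_ge0// sin_max.
split; first by exists K'.
pose A : R := 2 * N.+2%:R * (2 * N%:R + 3).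
pose B : R := 4 * N.+2%:R * N.+1%:R.
have A0 : 0 <= A by rewrite !mulr_ge0// addr_ge0// mulr_ge0.
have B0 : 0 <= B by rewrite !mulr_ge0.
exists (A * (D N.+1 + K') + B * K); split.
  by apply: addr_ge0; apply: mulr_ge0 => //; apply: addr_ge0.
move=> a a1.
have a0 : a != 0 by rewrite gt_eqF// (lt_le_trans ltr01).
have ai0 : 0 <= a^-1 by rewrite invr_ge0 (le_trans ler01).
have ai1 : a^-1 <= 1 by rewrite invf_le1// (lt_le_trans ltr01).
set x := a^-1 in ai0 ai1 *.
have -> : osc N.+2 a = (A * osc N.+1 a - B * osc N a) * x ^+ 2.
  by rewrite /A /B -oscSS /x; field.
have DB : D N.+2 = B * D N.
  rewrite /D /B !factS !natrM !exprS; ring.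
rewrite DB cS.
rewrite (_ : _ - _ = A * osc N.+1 a * x ^+ 2 -
   B * (osc N a - D N * c N a * x ^+ N.+1) * x ^+ 2); last first.
  by rewrite !exprS; ring.
have x2 : 0 <= x ^+ 2 by rewrite exprn_ge0.
clearbody A B.
rewrite (le_trans (ler_normB _ _))// 2!(normrM _ (x ^+ 2)) (ger0_norm x2).
rewrite (normrM A) (normrM B) (ger0_norm A0) (ger0_norm B0).
have h1 : `|osc N.+1 a| <= (D N.+1 + K') * x ^+ N.+2.
  rewrite -(subrK (D N.+1 * c N.+1 a * x ^+ N.+2) (osc N.+1 a)).
  rewrite (le_trans (ler_normD _ _))// mulrDl addrC lerD//.
    have xN : 0 <= x ^+ N.+2 by rewrite exprn_ge0.
    rewrite (normrM _ (x ^+ N.+2)) (ger0_norm xN) (normrM (D N.+1)) (ger0_norm (D0 _)).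
    rewrite ler_wpM2r//.
    by rewrite ler_piMr// cos_max.
  rewrite (le_trans (HK' _ a1))// ler_wpM2l// -/x exprS ler_piMl// exprn_ge0//.
rewrite [leRHS]mulrDl lerD//.
  rewrite (_ : A * _ * _ = A * ((D N.+1 + K') * x ^+ N.+2) * x ^+ 2); last first.
    by rewrite !exprS; ring.
  by rewrite ler_wpM2r// ler_wpM2l.
rewrite (_ : B * K * _ = B * (K * x ^+ N.+2) * x ^+ 2); last first.
  by rewrite !exprS; ring.
by rewrite ler_wpM2r// ler_wpM2l// HK.
Qed.

End oscillatory_integral.

(** * The kernel *)

Section bochner_riesz_kernel.
Context (R : realType).
Local Notation leb := (@lebesgue_measure R).
Local Notation RR := (measurableTypeR R).
Local Notation E n := (euclid R n).

Definition esub n (x y : E n) : E n := [tuple tnth x i - tnth y i | i < n].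

Lemma edot_esub n (x y z : E n) : edot z (esub x y) = edot z x - edot z y.
Proof.
rewrite /edot -sumrB; apply: eq_bigr => i _.
by rewrite tnth_mktuple mulrBr.
Qed.

Lemma edotC n (x y : E n) : edot x y = edot y x.
Proof. by apply: eq_bigr => i _; rewrite mulrC. Qed.

(** The inverse Fourier transform of the symbol; the symbol is even, so the sine part cancels and a
    cosine remains. *)
Definition br_kernel n (lam : R) (z : E n) : R :=
  \int[lebesgue R n]_xi (pospow lam (1 - esqnorm xi) * cos (2 * pi * edot xi z)).

Lemma measurable_symbol n (lam : R) :
  measurable_fun setT (fun x : E n => pospow lam (1 - esqnorm x)).
Proof.
apply: (measurableT_comp (measurable_pospow lam)).
by apply: measurable_funB; [exact: measurable_cst|exact: measurable_esqnorm].
Qed.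

Lemma measurable_cosr : measurable_fun setT (@cos R).
Proof. by apply: continuous_measurable_fun; exact: continuous_cos. Qed.

Lemma measurable_sinr : measurable_fun setT (@sin R).
Proof. by apply: continuous_measurable_fun; exact: continuous_sin. Qed.

Lemma integrable_symbol n (lam : R) : 0 < lam ->
  (lebesgue R n).-integrable setT (fun x => (pospow lam (1 - esqnorm x))%:E).
Proof.
move=> lam0; have [C [_ HC]] := integral_pospow n lam0.
apply/integrableP; split; first by apply/measurable_EFinP; exact: measurable_symbol.
under eq_integral do rewrite gee0_abs ?lee_fin ?pospow_ge0//.
by rewrite HC ltry.
Qed.

Lemma integral_pospow_itv n (h u : R -> R) : (0 < n)%N ->
  measurable_fun setT h -> (forall t, 0 <= h t) ->
  (forall t, (1 - t ^+ 2) ^+ n * h t = u t) ->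
  leb.-integrable `[(-1)%R, 1%R] (EFin \o u) ->
  (\int[leb]_t (pospow n%:R (1 - t ^+ 2) * h t)%:E =
   (\int[leb]_(t in `[(-1)%R, 1%R]) u t)%:E)%E.
Proof.
move=> n0 mh h0 uE iu; rewrite /Rintegral fineK; last exact: integrable_fin_num.
rewrite [RHS]integral_mkcond; apply: eq_integral => t _.
rewrite patchE; case: ifPn => [|].
  rewrite inE/= in_itv/= => /andP[t1 t2]; rewrite -uE; congr ((_ * _)%:E).
  have t3 : 0 <= 1 - t ^+ 2 by nra.
  by rewrite pospow_ge0E// powR_mulrn.
rewrite notin_setE/= in_itv/= => tN.
rewrite pospow_le0 ?mul0r ?ltr0n// leNgt; apply/negP => t2; apply: tN.
by apply/andP; split; nra.
Qed.

(** The profile formula is stated for non-negative [h], so it is applied to [1 + cos] and to [1],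
    and the results are subtracted. *)
Lemma br_kernel_osc n : (0 < n)%N -> exists C : R, 0 < C /\ forall z : E n.+1,
  br_kernel (n%:R / 2) z = C * osc n (2 * pi * Num.sqrt (esqnorm z)).
Proof.
move=> n0; have [C [C0 HC]] := integral_bochner_riesz_profile R n0.
have lam0 : (0 < n%:R / 2 :> R)%R by rewrite divr_gt0// ltr0n.
exists C; split=> // z; set a := 2 * pi * _.
have mc (k : R) : measurable_fun setT (fun t : R => 1 + cos (k * t)).
  apply: measurable_funD; first exact: measurable_cst.
  by apply: (measurableT_comp measurable_cosr); exact: mulrl_measurable.
have c0 (k t : R) : 0 <= 1 + cos (k * t) by have := cos_geN1 (k * t); lra.
have i0 := integrable_oscf n (0 : R).
have ia := integrable_oscf n a.
have E1 : (\int[lebesgue R n.+1]_x (pospow (n%:R / 2) (1 - esqnorm x))%:E =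
    (C * osc n 0)%:E)%E.
  have := HC z (cst 1) (measurable_cst _) (fun=> ler01).
  under eq_integral do rewrite /cst mulr1.
  move=> ->; rewrite EFinM; congr (_ * _)%E.
  apply: integral_pospow_itv => //.
  by move=> t; rewrite /oscf mul0r cos0.
have E2 : (\int[lebesgue R n.+1]_x
    (pospow (n%:R / 2) (1 - esqnorm x) * (1 + cos (2 * pi * edot x z)))%:E =
    (C * (osc n 0 + osc n a))%:E)%E.
  rewrite (HC z _ (mc _) (c0 _)) EFinM; congr (_ * _)%E.
  rewrite /osc -RintegralD//.
  have := @integral_pospow_itv n (fun t => 1 + cos (a * t)) (fun t => oscf n 0 t + oscf n a t).
  move=> <- //.
  - by apply: eq_integral => t _; rewrite /a; congr (_ * (1 + cos _))%:E; ring.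
  - by move=> t; rewrite /oscf mul0r cos0 mulrDr.
  - exact: (integrableD _ i0 ia).
have iM := integrable_symbol n.+1 lam0.
have iM2 : (lebesgue R n.+1).-integrable setT (fun x =>
    (pospow (n%:R / 2) (1 - esqnorm x) * (1 + cos (2 * pi * edot x z)))%:E).
  apply/integrableP; split.
    apply/measurable_EFinP; apply: measurable_funM; first exact: measurable_symbol.
    apply: (measurableT_comp (mc (2 * pi))).
    by apply: measurable_edot; [exact: measurable_id|exact: measurable_cst].
  under eq_integral do rewrite gee0_abs ?lee_fin ?mulr_ge0 ?pospow_ge0//.
  by rewrite E2 ltry.
rewrite /br_kernel.
transitivity (\int[lebesgue R n.+1]_x
  (pospow (n%:R / 2) (1 - esqnorm x) * (1 + cos (2 * pi * edot x z)) -
   pospow (n%:R / 2) (1 - esqnorm x))).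
  by apply: eq_Rintegral => x _; ring.
by rewrite (RintegralB measurableT iM2 iM) /Rintegral E1 E2 /=; ring.
Qed.

(** * The operator as convolution with the kernel *)

Section representation.
Variables (n : nat) (lam : R) (f : E n -> R).
Hypotheses (lam0 : 0 < lam) (mf : measurable_fun setT f) (f0 : forall y, 0 <= f y)
  (fi : (\int[lebesgue R n]_y (f y)%:E < +oo)%E).
Local Notation mu := (lebesgue R n).
Local Notation M xi := (pospow lam (1 - esqnorm xi)).

Lemma integrable_ge0_real : mu.-integrable setT (EFin \o f).
Proof.
apply/integrableP; split; first exact/measurable_EFinP.
by under eq_integral do rewrite gee0_abs ?lee_fin//.
Qed.

Lemma integrable_modulated (g : E n -> R) : measurable_fun setT g ->
  (forall y, `|g y| <= 1) -> mu.-integrable setT (EFin \o (fun y => f y * g y)).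
Proof.
move=> mg g1; apply: (le_integrable _ _ _ integrable_ge0_real) => //.
  exact/measurable_EFinP/measurable_funM.
move=> y _; rewrite /= lee_fin normrM !(ger0_norm (f0 y)).
by rewrite ler_piMr.
Qed.

Lemma cintegrable_real : cintegrable (fun y => (f y)%:C%C).
Proof.
split; first by split => //; exact: measurable_cst.
under eq_integral do rewrite /cabs /= expr0n/= addr0 sqrtr_sqr ger0_norm//.
exact: fi.
Qed.

Let phase (x xi y : E n) : R := 2 * pi * edot xi x - 2 * pi * edot y xi.

Let Phi (x : E n) (z : E n * E n) : \bar R := (M z.1 * (f z.2 * cos (phase x z.1 z.2)))%:E.

Let mPhi x : measurable_fun setT (Phi x).
Proof.
apply/measurable_EFinP; apply: measurable_funM.
  exact: (measurableT_comp (@measurable_symbol n lam) measurable_fst).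
apply: measurable_funM; first exact: (measurableT_comp mf measurable_snd).
apply: (measurableT_comp measurable_cosr).
apply: measurable_funB; apply: measurable_funM; try exact: measurable_cst.
  by apply: measurable_edot; [exact: measurable_fst|exact: measurable_cst].
by apply: measurable_edot; [exact: measurable_snd|exact: measurable_fst].
Qed.

Let iPhi x : (mu \x mu)%E.-integrable setT (Phi x).
Proof.
apply: (proj2 (integrable12ltyP mu mu (mPhi x))).
apply: (@le_lt_trans _ _ (\int[mu]_xi ((M xi)%:E * \int[mu]_y (f y)%:E))%E).
  apply: ge0_le_integral => //.
  - by move=> xi _; exact: integral_ge0.
  - apply: (measurable_fun_fubini_tonelli_F (abse \o Phi x)) => [|z]; last exact: abse_ge0.
    by apply: measurableT_comp => //; exact: mPhi.
  - apply: emeasurable_funM; last exact: measurable_cst.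
    by apply/measurable_EFinP; exact: measurable_symbol.
  - move=> xi _; rewrite -ge0_integralZl_EFin ?pospow_ge0//; last 2 first.
    + by move=> y _; rewrite lee_fin.
    + exact/measurable_EFinP.
    apply: ge0_le_integral => //.
    + by apply: measurableT_comp => //; apply: (measurableT_comp (mPhi x)); exact: pair1_measurable.
    + by apply: measurable_funeM; exact/measurable_EFinP.
    + move=> y _; rewrite /Phi/= lee_fin normrM (ger0_norm (pospow_ge0 _ _)).
      rewrite ler_wpM2l ?pospow_ge0// normrM (ger0_norm (f0 y)) ler_piMr//.
      exact: cos_max.
have [C [C0 HC]] := integral_pospow n lam0.
have F0 : (0 <= \int[mu]_y (f y)%:E)%E by apply: integral_ge0 => y _; rewrite lee_fin.
have Ff : (\int[mu]_y (f y)%:E)%E \is a fin_num by rewrite ge0_fin_numE.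
rewrite -(fineK Ff) ge0_integralZr//; last 3 first.
- by apply/measurable_EFinP; exact: measurable_symbol.
- by move=> xi _; rewrite lee_fin pospow_ge0.
- by rewrite fineK.
by rewrite HC -EFinM ltry.
Qed.

Let mphase x xi : measurable_fun setT (fun y => phase x xi y).
Proof.
apply: measurable_funB; first exact: measurable_cst.
apply: measurable_funM; first exact: measurable_cst.
by apply: measurable_edot; [exact: measurable_id|exact: measurable_cst].
Qed.

Let Phi_y x xi : (\int[mu]_y Phi x (xi, y) =
  (\int[mu]_y (M xi * (f y * cos (phase x xi y))))%:E)%E.
Proof.
rewrite /Rintegral fineK//; apply: integrable_fin_num => //.
have := integrable_modulated (measurableT_comp measurable_cosr (mphase x xi)) (fun y => cos_max _).
by move=> /(integrableZl measurableT (M xi)).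
Qed.

Let Re_integrand x xi :
  complex.Re ((M xi)%:C%C * fourier (fun y => (f y)%:C%C) xi * expi2pi (edot xi x)) =
  \int[mu]_y (M xi * (f y * cos (phase x xi y))).
Proof.
have mN : measurable_fun setT (fun y : E n => 2 * pi * - edot y xi).
  apply: measurable_funM; first exact: measurable_cst.
  apply: measurableT_comp => //.
  by apply: measurable_edot; [exact: measurable_id|exact: measurable_cst].
have ic := integrable_modulated (measurableT_comp measurable_cosr mN) (fun y => cos_max _).
have isn := integrable_modulated (measurableT_comp measurable_sinr mN) (fun y => sin_max _).
rewrite /fourier /cintegral /expi2pi /=.
set a := Rintegral _ _ _; set b := Rintegral _ _ _.
have -> : a = \int[mu]_y (f y * cos (2 * pi * - edot y xi)).
  by apply: eq_Rintegral => y _; rewrite mul0r subr0.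
have -> : b = \int[mu]_y (f y * sin (2 * pi * - edot y xi)).
  by apply: eq_Rintegral => y _; rewrite mul0r addr0.
have icZ := integrableZl measurableT (M xi * cos (2 * pi * edot xi x)) ic.
have isZ := integrableZl measurableT (M xi * sin (2 * pi * edot xi x)) isn.
transitivity (\int[mu]_y ((M xi * cos (2 * pi * edot xi x)) * (f y * cos (2 * pi * - edot y xi)) -
   (M xi * sin (2 * pi * edot xi x)) * (f y * sin (2 * pi * - edot y xi)))).
  rewrite (RintegralB measurableT icZ isZ).
  rewrite (RintegralZl _ measurableT ic) (RintegralZl _ measurableT isn).
  ring.
apply: eq_Rintegral => y _; rewrite /phase cosB mulrN cosN sinN; ring.
Qed.

(** Fubini for the double integral over frequency and space, dominated by [M xi * f y]. The real
    part is enough to bound the modulus from below. *)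
Lemma integral_kernel x : (\int[mu]_y (f y * br_kernel lam (esub x y))%:E =
  (complex.Re (bochner_riesz lam (fun y => (f y)%:C%C) x))%:E)%E.
Proof.
have := Fubini (iPhi x).
under eq_integral do rewrite Phi_y -Re_integrand.
have -> : (\int[mu]_y \int[mu]_xi Phi x (xi, y) =
    \int[mu]_y (f y * br_kernel lam (esub x y))%:E)%E.
  apply: eq_integral => y _; rewrite /br_kernel EFinM /Rintegral fineK; last first.
    apply: integrable_fin_num => //.
    apply: (le_integrable _ _ _ (integrable_symbol n lam0)) => //.
      apply/measurable_EFinP; apply: measurable_funM; first exact: measurable_symbol.
      apply: (measurableT_comp measurable_cosr).
      apply: measurable_funM; first exact: measurable_cst.
      by apply: measurable_edot; [exact: measurable_id|exact: measurable_cst].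
    move=> xi _; rewrite /= lee_fin normrM ler_piMr// cos_max//.
  rewrite -integralZl//.
    apply: eq_integral => xi _; rewrite /Phi -EFinM/= edot_esub /phase (edotC y xi).
    by rewrite mulrBr mulrCA.
  apply: (le_integrable _ _ _ (integrable_symbol n lam0)) => //.
    apply/measurable_EFinP; apply: measurable_funM; first exact: measurable_symbol.
    apply: (measurableT_comp measurable_cosr).
    apply: measurable_funM; first exact: measurable_cst.
    by apply: measurable_edot; [exact: measurable_id|exact: measurable_cst].
  move=> xi _; rewrite /= lee_fin normrM ler_piMr// cos_max//.
move=> <-; rewrite /bochner_riesz /cintegral /= /Rintegral fineK//.
have := integrable_fubini_F (iPhi x); rewrite /fubini_F.
under [X in _.-integrable _ X -> _]eq_fun do rewrite Phi_y -Re_integrand.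
exact: integrable_fin_num.
Qed.

End representation.
End bochner_riesz_kernel.

(** * Boxes and norms *)

Section rectangles.
Context (R : realType).
Local Notation leb := (@lebesgue_measure R).
Local Notation RR := (measurableTypeR R).
Local Notation E n := (euclid R n).

Lemma measurable_le_set d (T : measurableType d) (f g : T -> R) :
  measurable_fun setT f -> measurable_fun setT g -> measurable [set x | f x <= g x].
Proof.
move=> mf mg; have := measurable_fun_le measurableT mf mg.
by rewrite setTI.
Qed.

Lemma measurable_lt_set d (T : measurableType d) (f g : T -> R) :
  measurable_fun setT f -> measurable_fun setT g -> measurable [set x | f x < g x].
Proof.
move=> mf mg; rewrite (_ : [set x | _] = ~` [set x | g x <= f x]).
  by apply: measurableC; exact: measurable_le_set.
by apply/seteqP; split => x /=; rewrite ltNge => /negP.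
Qed.

Lemma measurable_forall d (T : measurableType d) n (P : 'I_n -> T -> Prop) :
  (forall i, measurable [set x | P i x]) -> measurable [set x | forall i, P i x].
Proof.
move=> mP; rewrite (_ : [set x | _] = \bigcap_(i in setT) [set x | P i x]).
  by apply: fin_bigcap_measurable => // i _; exact: mP.
by apply/seteqP; split => [x h i _|x h i]; exact: h.
Qed.

Definition rect n (a b : 'I_n -> R) : set (E n) :=
  [set x | forall i, a i <= tnth x i <= b i].

Lemma measurable_rect n (a b : 'I_n -> R) : measurable (rect a b).
Proof.
apply: measurable_forall => i.
rewrite (_ : [set x | _] =
  [set x : E n | a i <= tnth x i] `&` [set x : E n | (tnth x i : R) <= b i]).
  by apply: measurableI; apply: measurable_le_set;
    (exact: measurable_cst || exact: measurable_coord).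
by apply/seteqP; split => [x /= /andP[]//|x [/= -> ->]].
Qed.

Lemma forall_ordS n (P : 'I_n.+1 -> Prop) :
  (forall i, P i) <-> P ord0 /\ forall i, P (lift ord0 i).
Proof.
split=> [h|[h0 hS] i]; first by split.
by case: (unliftP ord0 i) => [j ->|->].
Qed.

Lemma lebesgue_rect n (a b : 'I_n -> R) : (forall i, a i <= b i) ->
  lebesgue R n (rect a b) = (\prod_i (b i - a i))%:E.
Proof.
elim: n a b => [|n IH] a b ab.
  rewrite big_ord0 /= diracE mem_set//.
  by case.
pose a' i := a (lift ord0 i); pose b' i := b (lift ord0 i).
rewrite big_ord_recl EFinM -IH//.
transitivity ((leb \x lebesgue R n)%E (`[a ord0, b ord0]%classic `*` rect a' b')).
  change ((leb \x lebesgue R n)%E (@econs R n @^-1` rect a b) =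
    (leb \x lebesgue R n)%E (`[a ord0, b ord0]%classic `*` rect a' b')).
  congr ((leb \x lebesgue R n)%E _); apply/seteqP; split => -[t x] /=.
    rewrite /rect/= forall_ordS => -[h0 hS]; split=> /=; first by rewrite in_itv.
    by move=> i; have := hS i; rewrite tnth_econsS.
  move=> [/= h0 hS]; rewrite /rect/= forall_ordS; split.
    by move: h0; rewrite in_itv.
  by move=> i; rewrite tnth_econsS; exact: hS.
rewrite product_measure1E//; last exact: measurable_rect.
congr (_ * _)%E; suff L : leb `[a ord0, b ord0]%classic = (b ord0 - a ord0)%:E by exact: L.
rewrite lebesgue_measure_itv/= lte_fin; case: ltP => // h; rewrite ?EFinB//.
have -> : b ord0 = a ord0 by apply/eqP; rewrite eq_le h ab.
by rewrite -EFinB subrr.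
Qed.

Lemma cube_rect n (a : E n) (l : R) :
  cube a l = rect (fun i => tnth a i) (fun i => tnth a i + l).
Proof. by []. Qed.

Lemma measurable_cube n (a : E n) (l : R) : measurable (cube a l).
Proof. exact: measurable_rect. Qed.

Lemma lebesgue_cube n (a : E n) (l : R) : 0 <= l ->
  lebesgue R n (cube a l) = (l ^+ n)%:E.
Proof.
move=> l0; rewrite cube_rect lebesgue_rect => [|i]; last by rewrite lerDl.
congr EFin; under eq_bigr do rewrite addrAC subrr add0r.
by rewrite prodr_const card_ord.
Qed.

Definition box n (r : R) : set (E n) := rect (fun=> - r) (fun=> r).

Arguments box n r : clear implicits.

Lemma measurable_box n (r : R) : measurable (box n r).
Proof. exact: measurable_rect. Qed.

Lemma boxP n (r : R) (x : E n) : box n r x <-> forall i, `|tnth x i| <= r.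
Proof. by split=> h i; have := h i; rewrite ler_norml. Qed.

Lemma lebesgue_box n (r : R) : 0 <= r -> lebesgue R n (box n r) = ((2 * r) ^+ n)%:E.
Proof.
move=> r0; rewrite lebesgue_rect => [|i]; last by rewrite ge0_cp.
congr EFin; under eq_bigr do rewrite opprK.
by rewrite prodr_const card_ord mulr_natl mulr2n.
Qed.

Lemma subset_box n (r s : R) : r <= s -> box n r `<=` box n s.
Proof. by move=> rs x /boxP h; apply/boxP => i; exact: le_trans (h i) rs. Qed.

Definition shift1 n (s : R) (x : E n.+1) : E n.+1 :=
  econs (tnth x ord0 + s, [tuple of behead x]).

Lemma shift1_econs n (s t : R) (x : E n) : shift1 s (econs (t, x)) = econs (t + s, x).
Proof. by rewrite /shift1; congr (econs (_, _)); apply: val_inj. Qed.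

Lemma measurable_shift1 n s : measurable_fun setT (@shift1 n s).
Proof.
apply: (measurableT_comp (@measurable_econs R n)); apply: measurable_fun_pair.
  by apply: (@measurable_funD _ _ R); [exact: measurable_coord|exact: measurable_cst].
exact: measurable_behead.
Qed.

Lemma lebesgue_shift1 n (s : R) (A : set (E n.+1)) : measurable A ->
  lebesgue R n.+1 (shift1 s @^-1` A) = lebesgue R n.+1 A.
Proof.
move=> mA.
have mS : measurable (shift1 s @^-1` A).
  by rewrite -[X in measurable X]setTI; exact: measurable_shift1.
have mI (B : set (E n.+1)) : measurable B -> measurable_fun setT (fun x => (\1_B x)%:E : \bar R).
  by move=> mB; apply/measurable_EFinP; exact: measurable_indic.
have L (B : set (E n.+1)) : measurable B ->
    lebesgue R n.+1 B = (\int[lebesgue R n.+1]_x (\1_B x)%:E)%E.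
  by move=> mB; rewrite integral_indic// setIT.
rewrite (L _ mS) (L _ mA).
rewrite (lebesgueSE (mI _ mS)) => [|x]; last by rewrite lee_fin.
rewrite (lebesgueSE (mI _ mA)) => [|x]; last by rewrite lee_fin.
pose F (t : RR) := (\int[lebesgue R n]_x (\1_A (econs (t, x)))%:E)%E.
transitivity (\int[leb]_t F (t + s)%R)%E.
  apply: eq_integral => t _; apply: eq_integral => x _; congr EFin.
  rewrite -shift1_econs !indicE.
  suff -> : (econs (t, x) \in shift1 s @^-1` A) = (shift1 s (econs (t, x)) \in A) by [].
  by apply/idP/idP; rewrite !inE.
apply: ge0_integral_shift.
  apply: (measurable_lebesgue_param (f := fun z => (\1_A (econs z))%:E)).
    by apply: (measurableT_comp (mI _ mA)); exact: measurable_econs.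
  by move=> x; rewrite lee_fin.
by move=> t; apply: integral_ge0 => x _; rewrite lee_fin.
Qed.

End rectangles.
Arguments box {R} n r.

(** * The Euclidean norm against the maximum norm *)

Section norm.
Context (R : realType).
Local Notation E n := (euclid R n).

Definition enorm n (x : E n) : R := Num.sqrt (esqnorm x).

Lemma enorm_ge0 n (x : E n) : 0 <= enorm x.
Proof. exact: sqrtr_ge0. Qed.

Lemma sqr_enorm n (x : E n) : enorm x ^+ 2 = esqnorm x.
Proof. by rewrite sqr_sqrtr// esqnorm_ge0. Qed.

Lemma measurable_enorm n : measurable_fun setT (@enorm n).
Proof.
apply: (measurableT_comp _ (@measurable_esqnorm R n)).
by apply: continuous_measurable_fun; exact: sqrt_continuous.
Qed.

Lemma coord_le_enorm n (x : E n) i : `|tnth x i| <= enorm x.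
Proof.
rewrite -(@ler_pXn2r _ 2%N) ?nnegrE ?enorm_ge0// sqr_enorm real_normK ?num_real//.
rewrite /esqnorm /edot (bigD1 i)//= expr2 lerDl.
by apply: sumr_ge0 => j _; rewrite -expr2 sqr_ge0.
Qed.

Lemma enorm_box n (r : R) (x : E n) : 0 <= r -> box n r x -> enorm x <= n%:R * r.
Proof.
move=> r0 /boxP h; rewrite -(@ler_pXn2r _ 2%N) ?nnegrE ?enorm_ge0 ?mulr_ge0// sqr_enorm.
apply: (@le_trans _ _ (n%:R * r ^+ 2)).
  rewrite mulr_natl -{2}(card_ord n) -sumr_const; apply: ler_sum => i _.
  by rewrite -expr2 -(real_normK (num_real _)) lerXn2r ?nnegrE.
rewrite exprMn ler_wpM2r ?sqr_ge0// -natrX ler_nat.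
by case: n {x h} => // n; rewrite leq_pmulr.
Qed.

(* Both sides are multiplied by the sum of the norms, which avoids the triangle
   inequality for [enorm]. *)
Lemma enorm_esub n (r : R) (x y : E n) : 0 <= r -> box n r x ->
  `|enorm (esub x y) - enorm y| <= n%:R * r.
Proof.
move=> r0 /boxP h; set u := enorm _; set v := enorm y.
have u0 : 0 <= u by exact: enorm_ge0.
have v0 : 0 <= v by exact: enorm_ge0.
have [uv|uv] := leP (u + v) 0.
  have -> : u = 0 by lra.
  have -> : v = 0 by lra.
  by rewrite subrr normr0 mulr_ge0.
rewrite -(ler_pM2r uv) -{1}(gtr0_norm uv) -normrM.
have -> : (u - v) * (u + v) = \sum_(i < n) tnth x i * (tnth x i - 2 * tnth y i).
  transitivity (u ^+ 2 - v ^+ 2); first by ring.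
  rewrite !sqr_enorm /esqnorm /edot -sumrB; apply: eq_bigr => i _.
  by rewrite tnth_mktuple; ring.
rewrite (le_trans (ler_norm_sum _ _ _))//.
have -> : n%:R * r * (u + v) = \sum_(i < n) r * (u + v).
  by rewrite sumr_const card_ord -mulrA mulr_natl.
apply: ler_sum => i _; rewrite normrM ler_pM//.
have -> : tnth x i - 2 * tnth y i = tnth (esub x y) i - tnth y i.
  by rewrite tnth_mktuple; ring.
by rewrite (le_trans (ler_normB _ _))// lerD// coord_le_enorm.
Qed.

End norm.

(** * Phases of the cosine *)

Section phases.
Context (R : realType).

Lemma cos_lipschitz (a b : R) : `|cos a - cos b| <= `|a - b|.
Proof.
wlog ab : a b / a <= b.
  move=> h; have [/h//|/ltW/h] := leP a b.
  by rewrite distrC [leRHS]distrC.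
have [c _ E] := @MVT_segment R cos (fun x => - sin x) a b ab
  (fun x _ => is_derive_cos x) (continuous_subspaceT (@continuous_cos R)).
by rewrite distrC E normrM normrN distrC ler_piMl// sin_max.
Qed.

(** Quarter turns run through [cos], [- sin], [- cos], [sin], and one of these is at least
    [1 / sqrt 2 > 7 / 10]. *)
Lemma cos_quarter_turns (a : R) :
  exists2 j : 'I_4, true & 7 / 10 <= cos (a + j%:R * (pi / 2)).
Proof.
have c1 x : cos (x + 1%:R * (pi / 2)) = - sin x by rewrite mul1r cosDpihalf.
have c2 x : cos (x + 2%:R * (pi / 2)) = - cos x.
  by rewrite (_ : 2%:R * (pi / 2) = pi) ?cosDpi//; field.
have c3 x : cos (x + 3%:R * (pi / 2)) = sin x.
  rewrite (_ : x + _ = (x + 1%:R * (pi / 2)) + 2%:R * (pi / 2)); last by field.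
  by rewrite c2 c1 opprK.
have sc := cos2Dsin2 a.
have [|c7] := leP (7 / 10) (cos a).
  by exists ord0 => //; rewrite mul0r addr0.
have [|s7] := leP (7 / 10) (sin a); first by exists (@Ordinal 4 3 isT) => //; rewrite c3.
have [|cN7] := leP (7 / 10) (- cos a); first by exists (@Ordinal 4 2 isT) => //; rewrite c2.
have [|sN7] := leP (7 / 10) (- sin a); first by exists (@Ordinal 4 1 isT) => //; rewrite c1.
exfalso; nra.
Qed.

Lemma pi_le4 : pi <= 4 :> R.
Proof. by have := @pihalf_lt2 R; lra. Qed.

End phases.

(** * Lower bound for the kernel *)

Section good_set.
Context (R : realType) (n : nat).
Local Notation leb := (@lebesgue_measure R).
Local Notation E n := (euclid R n).
Hypothesis n0 : (0 < n)%N.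

(** [eps] keeps the part of a vector transversal to the first axis at most [rho / 8] in norm; [phi]
    is the phase in the asymptotics of [osc n]. *)
Let eps : R := (8 * n.+1%:R)^-1.
Let phi : R := n.+1%:R * (pi / 2).

Let eps_gt0 : 0 < eps.
Proof. by rewrite invr_gt0 mulr_gt0// ltr0n. Qed.

Let eps_le1 : eps <= 1.
Proof. by rewrite invf_le1 ?mulr_gt0 ?ltr0n// -natrM ler1n. Qed.

Let neps : n%:R * eps <= 1 / 8.
Proof.
rewrite /eps ler_pdivrMr ?mulr_gt0 ?ltr0n// (_ : 1 / 8 * (8 * n.+1%:R) = n.+1%:R); last by field.
by rewrite ler_nat.
Qed.

(* The first coordinate dominates, so that translating [y] by [j / 4] along the
   first axis increases [enorm y] by almost [j / 4]: the phase of the kernel makes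
   [j] quarter turns. *)
Definition good (rho : R) : set (E n.+1) := [set y |
  [/\ rho / 2 < tnth y ord0, (tnth y ord0 : R) <= rho,
      forall i : 'I_n, `|tnth y (lift ord0 i)| <= eps * rho &
      3 / 5 <= cos (2 * pi * enorm y - phi)]].

Lemma measurable_good rho : measurable (good rho).
Proof.
have c0 := @measurable_coord R n.+1 ord0.
have -> : good rho = [set y | rho / 2 < tnth y ord0] `&` [set y | (tnth y ord0 : R) <= rho]
   `&` [set y | forall i : 'I_n, `|tnth y (lift ord0 i)| <= eps * rho]
   `&` [set y | 3 / 5 <= cos (2 * pi * enorm y - phi)].
  by apply/seteqP; split => [y [? ? ? ?]|y [[[? ?] ?] ?]].
apply: measurableI.
  apply: measurableI.
    by apply: measurableI; [apply: measurable_lt_set|apply: measurable_le_set];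
      (exact: measurable_cst || exact: c0).
  apply: measurable_forall => i; apply: measurable_le_set; last exact: measurable_cst.
  by apply: measurableT_comp => //; exact: measurable_coord.
apply: measurable_le_set; first exact: measurable_cst.
apply: (measurableT_comp (@measurable_cosr R)).
apply: measurable_funB; last exact: measurable_cst.
by apply: measurable_funM; [exact: measurable_cst|exact: measurable_enorm].
Qed.

Lemma good_sub_box rho : 0 < rho -> good rho `<=` box n.+1 rho.
Proof.
move=> rho0 y [h1 h2 h3 _]; apply/boxP/forall_ordS; split.
  by rewrite gtr0_norm// (lt_trans _ h1)// divr_gt0.
by move=> i; rewrite (le_trans (h3 i))// ler_piMl// ltW.
Qed.

Lemma good_not_box rho r y : r <= rho / 2 -> good rho y -> ~ box n.+1 r y.
Proof.
move=> r2 [h1 _ _ _] /boxP /(_ ord0) h.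
by have := lt_le_trans h1 (le_trans (ler_norm _) (le_trans h r2)); rewrite ltxx.
Qed.

(** [v^2 - u^2 = s * (2 * t + s)] holds exactly, and the two norms exceed the first coordinates
    [t + s] and [t] by a factor of at most 65/64, since [sqrt (1 + 1/32) <= 65/64]. *)
Lemma enorm_shift1 (t s : R) (x : E n) : 0 < t -> 0 <= s -> esqnorm x <= t ^+ 2 / 32 ->
  `|enorm (shift1 s (econs (t, x))) - enorm (econs (t, x)) - s| <= s / 64.
Proof.
move=> t0 s0 q.
rewrite shift1_econs; set v := enorm (econs (t + s, x)); set u := enorm _.
have v2 : v ^+ 2 = (t + s) ^+ 2 + esqnorm x by rewrite sqr_enorm esqnorm_econs.
have u2 : u ^+ 2 = t ^+ 2 + esqnorm x by rewrite sqr_enorm esqnorm_econs.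
have v0 : 0 <= v by exact: enorm_ge0.
have u0 : 0 <= u by exact: enorm_ge0.
have q0 := esqnorm_ge0 x.
move: (esqnorm x) q q0 u2 v2 => Q q q0 u2 v2.
have tu : t <= u by nra.
have tv : t + s <= v by nra.
have ut : u <= t * (65 / 64) by nra.
have vt : v <= (t + s) * (65 / 64) by nra.
have E : (v - u) * (v + u) = s * (2 * t + s).
  by transitivity (v ^+ 2 - u ^+ 2); [ring|rewrite v2 u2; ring].
have h1 : v - u <= s.
  rewrite -(@ler_pM2r _ (v + u)); last lra.
  by rewrite E ler_wpM2l//; lra.
have h2 : s <= (v - u) * (65 / 64).
  rewrite -(@ler_pM2r _ (2 * t + s)); last lra.
  rewrite -E -mulrA ler_wpM2l//; [|lra].
  by nra.
rewrite ler_norml; apply/andP; split; lra.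
Qed.

(** The margins leave room for translations by up to 3/4 within the range of [good rho]; for
    [rho >= 8] the first side, [rho / 4 - 1], is still at least [rho / 8]. *)
Let D (rho : R) : set (E n.+1) :=
  rect (fun i => if i == ord0 then 3 / 4 * rho else - (eps * rho))
       (fun i => if i == ord0 then rho - 1 else eps * rho).

Let D_cover rho y : 8 <= rho -> D rho y ->
  exists j : 'I_4, good rho (shift1 (j%:R / 4) y).
Proof.
move=> rho8; have [t [x ->]] := econsP y.
rewrite /D /rect/= forall_ordS eqxx tnth_econs0 => -[/andP[t1 t2] hx].
have {}hx i : `|tnth x i| <= eps * rho.
  by have := hx i; rewrite tnth_econsS ler_norml.
have rho0 : 0 < rho by lra.
have er0 : 0 <= eps * rho by rewrite mulr_ge0// ltW.
have bx : box n (eps * rho) x by apply/boxP.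
have xn := enorm_box er0 bx.
have xn8 : enorm x <= rho / 8.
  by rewrite (le_trans xn)// mulrA; have := neps; nra.
have q : esqnorm x <= t ^+ 2 / 32.
  by rewrite -sqr_enorm; have := enorm_ge0 x; nra.
have t0 : 0 < t by lra.
have [j _ hj] := cos_quarter_turns (2 * pi * enorm (econs (t, x)) - phi).
exists j; have j3 : j%:R <= 3 :> R by rewrite ler_nat -ltnS ltn_ord.
have j0 : 0 <= j%:R :> R by [].
have s0 : 0 <= j%:R / 4 :> R by rewrite divr_ge0.
have := enorm_shift1 t0 s0 q.
rewrite shift1_econs; set v := enorm (econs (t + _, x)) => hv.
split.
- by rewrite tnth_econs0; lra.
- by rewrite tnth_econs0; lra.
- by move=> i; rewrite tnth_econsS; exact: hx.
- rewrite -/v; set a := 2 * pi * enorm _ - phi in hj.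
  have := cos_lipschitz (2 * pi * v - phi) (a + j%:R * (pi / 2)).
  rewrite (_ : _ - _ - (a + _) = 2 * pi * (v - enorm (econs (t, x)) - j%:R / 4)); last first.
    by rewrite /a; field.
  rewrite normrM ger0_norm ?mulr_ge0 ?pi_ge0// => h.
  have p4 := @pi_le4 R; have p0 := @pi_ge0 R.
  (* The shift is at most 3/4 and the norm follows it up to 1/64 of it, so the phase misses its
     quarter turns by at most [8 * (3 / 4 / 64)]; hence the threshold [3 / 5], below
     [7 / 10 - 1 / 10] by nothing, in [good]. *)
  have : `|cos (2 * pi * v - phi) - cos (a + j%:R * (pi / 2))| <= 1 / 10.
    rewrite (le_trans h)//.
    apply: (@le_trans _ _ (8 * (3 / 4 / 64))); last lra.
    by apply: ler_pM; rewrite ?mulr_ge0//; lra.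
  by rewrite ler_norml => /andP[h1 _]; lra.
Qed.

(** Four translates of [good rho] cover the box [D rho], and all have the same measure. The factor
    1/32 is 1/4 for the number of translates times 1/8 for the first side of the box. *)
Lemma lebesgue_good : exists c : R, 0 < c /\ forall rho, 8 <= rho ->
  ((c * rho ^+ n.+1)%:E <= lebesgue R n.+1 (good rho))%E.
Proof.
exists ((2 * eps) ^+ n / 32); split; first by rewrite divr_gt0// exprn_gt0// mulr_gt0.
move=> rho rho8; have rho0 : 0 < rho by lra.
pose A (j : nat) := shift1 (j%:R / 4) @^-1` good rho.
have mA j : measurable (A j).
  by rewrite -[X in measurable X]setTI; apply: measurable_shift1 => //; exact: measurable_good.
have mD : measurable (D rho) by exact: measurable_rect.
have DA : D rho `<=` A 0%N `|` (A 1%N `|` (A 2%N `|` A 3%N)).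
  move=> y /(D_cover rho8)[[j /= j4] hj].
  by case: j j4 hj => [|[|[|[|//]]]] _ hj; [left|right; left|right; right; left|right; right; right].
have le4 : (lebesgue R n.+1 (D rho) <= 4%:E * lebesgue R n.+1 (good rho))%E.
  apply: (@le_trans _ _ (lebesgue R n.+1 (A 0%N `|` (A 1%N `|` (A 2%N `|` A 3%N))))).
    by apply: le_measure; rewrite ?inE//; do 3 (apply: measurableU => //).
  have mAj j : lebesgue R n.+1 (A j) = lebesgue R n.+1 (good rho).
    by apply: lebesgue_shift1; exact: measurable_good.
  have -> : (4%:E * lebesgue R n.+1 (good rho) = lebesgue R n.+1 (good rho) +
      (lebesgue R n.+1 (good rho) + (lebesgue R n.+1 (good rho) + lebesgue R n.+1 (good rho))))%E.
    case: (lebesgue R n.+1 (good rho)) => [r| |].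
    - by rewrite -EFinM -!EFinD; congr EFin; ring.
    - by rewrite gt0_muley ?lte_fin.
    - by rewrite gt0_muleNy ?lte_fin.
  have m23 : measurable (A 2%N `|` A 3%N) by exact: measurableU.
  have m123 : measurable (A 1%N `|` (A 2%N `|` A 3%N)) by exact: measurableU.
  rewrite -{1}(mAj 0%N); apply: (le_trans (measureU2 _ (mA 0%N) m123)); apply: leeD => //.
  rewrite -{1}(mAj 1%N); apply: (le_trans (measureU2 _ (mA 1%N) m23)); apply: leeD => //.
  rewrite -{1}(mAj 2%N) -(mAj 3%N).
  exact: (measureU2 _ (mA 2%N) (mA 3%N)).
rewrite -(@lee_pmul2l _ 4%:E)//; apply: le_trans le4.
rewrite lebesgue_rect; last first.
  move=> i; case: ifP => _; first lra.
  by rewrite ge0_cp// mulr_ge0// ltW.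
rewrite big_ord_recl eqxx -EFinM lee_fin.
under eq_bigr do rewrite eq_sym (negbTE (neq_lift _ _)) opprK.
rewrite prodr_const card_ord exprS.
have -> : eps * rho + eps * rho = (2 * eps) * rho by ring.
rewrite [X in _ <= _ * X]exprMn.
have -> : 4 * ((2 * eps) ^+ n / 32 * (rho * rho ^+ n)) =
   (rho / 8) * ((2 * eps) ^+ n * rho ^+ n) by field.
apply: ler_wpM2r; last lra.
by rewrite mulr_ge0// exprn_ge0// ?mulr_ge0// ltW.
Qed.

(** Passing from [enorm y] to [enorm (esub x y)] costs at most 1/80, so the phase changes by at most
    1/10 and the cosine stays at least 1/2. [rho >= 8 * K] then makes the error of the asymptotics
    at most half of [a^-1 ^+ n.+1], below which the main term does not fall. *)
Lemma br_kernel_good : exists c rho0 : R, [/\ 0 < c, 8 <= rho0 &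
  forall rho kappa x y, rho0 <= rho -> 0 <= kappa -> 80 * n.+1%:R * kappa <= 1 ->
    good rho y -> box n.+1 kappa x ->
    c * rho^-1 ^+ n.+1 <= br_kernel (n%:R / 2) (esub x y)].
Proof.
have [C [C0 HC]] := br_kernel_osc R n0.
have [K [K0 HK]] := osc_asymptotic R n.
(* [2 * pi <= 8], and [enorm (esub x y)] is at most [n.+2%:R * rho]; together they give
   [a <= B * rho]. *)
pose B : R := 8 * n.+2%:R.
have B0 : 0 < B by rewrite mulr_gt0// ltr0n.
exists (C / 2 * B^-1 ^+ n.+1), (8 + 8 * K).
have rho8 : 8 <= 8 + 8 * K by lra.
split=> //; first by rewrite mulr_gt0 ?divr_gt0// exprn_gt0 ?invr_gt0.
move=> rho kappa x y hrho k0 hk gy bx.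
have rho0 : 0 < rho by lra.
have yb := good_sub_box rho0 gy.
have [y1 _ _ y4] := gy.
have := enorm_esub y k0 bx; set u := enorm _; set v := enorm y => uv.
have uv80 : `|u - v| <= 1 / 80 by rewrite (le_trans uv)//; lra.
have vub : v <= n.+1%:R * rho by apply: enorm_box => //; exact: ltW.
have vlb : rho / 2 < v.
  by rewrite (lt_le_trans y1)// (le_trans (ler_norm _))// coord_le_enorm.
have [u1 u2] : v - 1/80 <= u /\ u <= v + 1/80.
  by move: uv80; rewrite ler_norml => /andP[]; lra.
have p4 := @pi_le4 R; have p2 := @pi_ge2 R.
rewrite HC -/(enorm _) -/u; set a := 2 * pi * u.
have cosa : 1 / 2 <= cos (a - phi).
  have := cos_lipschitz (a - phi) (2 * pi * v - phi).
  rewrite (_ : _ - phi - _ = 2 * pi * (u - v)); last by rewrite /a; ring.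
  rewrite normrM ger0_norm ?mulr_ge0 ?pi_ge0// => h.
  have : `|cos (a - phi) - cos (2 * pi * v - phi)| <= 1 / 10.
    rewrite (le_trans h)//; apply: (@le_trans _ _ (8 * (1 / 80))); last lra.
    by apply: ler_pM; rewrite ?mulr_ge0//; lra.
  by rewrite ler_norml => /andP[h1 _]; lra.
have ulb : rho / 4 <= u by lra.
have alb : rho <= a by rewrite /a; nra.
have aub : a <= B * rho.
  apply: (@le_trans _ _ (8 * u)); first by rewrite /a; nra.
  rewrite /B -mulrA ler_wpM2l// -natr1 mulrDl mul1r; lra.
have a1 : 1 <= a by lra.
have a0 : 0 < a by lra.
have := HK a a1; rewrite ler_norml => /andP[+ _].
rewrite -/phi; set A := a^-1 ^+ n.+1; set F := 2 ^+ n.+1 * _.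
have A0 : 0 <= A by rewrite exprn_ge0// invr_ge0 ltW.
have F2 : 2 <= F.
  rewrite /F exprS -mulrA ler_peMr// mulr_ege1//.
    by rewrite exprn_ege1// ler1n.
  by rewrite ler1n fact_gt0.
have KA : K * a^-1 ^+ n.+2 <= A / 2.
  rewrite exprS mulrA -/A mulrC ler_wpM2l//.
  by rewrite ler_pdivrMr//; lra.
have FA : A <= F * cos (a - phi) * A.
  by rewrite ler_peMl//; nra.
move=> h; have oscA : A / 2 <= osc n a by lra.
have AB : B^-1 ^+ n.+1 * rho^-1 ^+ n.+1 <= A.
  rewrite -exprMn -invfM mulrC; apply: lerXn2r.
  - by rewrite nnegrE invr_ge0 mulr_ge0// ltW.
  - by rewrite nnegrE invr_ge0 ltW.
  - by rewrite mulrC lef_pV2 ?posrE// mulr_gt0.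
have h1 := ler_wpM2l (ltW C0) AB; have h2 := ler_wpM2l (ltW C0) oscA.
lra.
Qed.

End good_set.

(** * The dyadic weight *)

Section dyadic_weight.
Context (R : realType) (n : nat).
Local Notation E := (euclid R n).
Local Notation mu := (lebesgue R n).
Hypothesis n0 : (0 < n)%N.
Variable M : nat.

(** The exponents are shifted to be natural numbers: [rad 0 = 2^-M], [rad M = 1],
    [rad (2 * M) = 2^M]. *)
Definition rad (k : nat) : R := 2 ^+ k / 2 ^+ M.

Lemma rad_gt0 k : 0 < rad k.
Proof. by rewrite divr_gt0// exprn_gt0. Qed.

Lemma radS k : rad k.+1 = 2 * rad k.
Proof. by rewrite /rad exprS mulrA. Qed.

Lemma radDM k : rad (M + k) = 2 ^+ k.
Proof. by rewrite /rad exprD mulrC mulKf// expf_neq0. Qed.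

Lemma rad_le j k : (j <= k)%N -> rad j <= rad k.
Proof. by move=> jk; rewrite ler_wpM2r ?invr_ge0 ?exprn_ge0// ler_weXn2l// ler1n. Qed.

Definition coef k : R := (rad k)^-1 ^+ n.

Lemma coef_gt0 k : 0 < coef k.
Proof. by rewrite exprn_gt0// invr_gt0 rad_gt0. Qed.

Lemma coef_le (s : R) k : 0 < s -> s <= rad k -> coef k <= s^-1 ^+ n.
Proof.
move=> s0 sk; rewrite /coef lerXn2r ?nnegrE ?invr_ge0 ?(ltW s0) ?(ltW (rad_gt0 _))//.
by rewrite lef_pV2 ?posrE ?rad_gt0.
Qed.

Lemma coef_ge (s : R) k : rad k <= s -> s^-1 ^+ n <= coef k.
Proof.
move=> sk; have s0 : 0 < s by exact: lt_le_trans (rad_gt0 k) sk.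
rewrite /coef lerXn2r ?nnegrE ?invr_ge0 ?(ltW s0) ?(ltW (rad_gt0 _))//.
by rewrite lef_pV2 ?posrE ?rad_gt0.
Qed.

(* Up to constants, [|x|^-n] for [|x|] (the maximum norm) clamped between [2^-M]
   and [2^M]; the leading constant keeps it positive at infinity. *)
Definition dyadic_weight (x : E) : R :=
  coef (2 * M) + \sum_(k < (2 * M).+1) coef k * \1_(box n (rad k)) x.

Lemma dyadic_weight_ge_coef x : coef (2 * M) <= dyadic_weight x.
Proof.
by rewrite lerDl; apply: sumr_ge0 => k _; rewrite mulr_ge0// ltW// coef_gt0.
Qed.

Lemma dyadic_weight_gt0 x : 0 < dyadic_weight x.
Proof. exact: lt_le_trans (coef_gt0 _) (dyadic_weight_ge_coef x). Qed.

Lemma measurable_dyadic_weight : measurable_fun setT dyadic_weight.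
Proof.
apply: measurable_funD; first exact: measurable_cst.
apply: measurable_sum => k; apply: measurable_funM; first exact: measurable_cst.
by apply: measurable_indic; exact: measurable_box.
Qed.

(** The least scale [rad j >= s] is at most [2 * s], and its summand alone suffices; beyond the last
    scale the leading constant takes over. *)
Lemma dyadic_weight_lower (s : R) y : rad 0 <= s -> box n s y -> (2 * s)^-1 ^+ n <= dyadic_weight y.
Proof.
move=> rs by_; have s0 : 0 < s by exact: lt_le_trans (rad_gt0 0) rs.
have [s2M|s2M] := leP (rad (2 * M)) s.
  by rewrite (le_trans _ (dyadic_weight_ge_coef y))// coef_ge//; lra.
have ex : exists j, s <= rad j by exists (2 * M)%N; exact: ltW.
pose j := ex_minn ex.
have [sj jmin] : s <= rad j /\ forall i, s <= rad i -> (j <= i)%N.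
  by rewrite /j; case: ex_minnP.
have j2M : (j < (2 * M).+1)%N by rewrite ltnS jmin// ltW.
have rj : rad j <= 2 * s.
  case: j sj jmin {j2M} => [|j] sj jmin; first lra.
  rewrite radS ler_pM2l// leNgt; apply/negP => /ltW/jmin.
  by rewrite ltnn.
apply: (le_trans (coef_ge rj)).
rewrite /dyadic_weight (bigD1 (Ordinal j2M))//= addrCA.
rewrite indicE mem_set/=; last exact: subset_box by_.
rewrite mulr1 lerDl addr_ge0// ?(ltW (coef_gt0 _))//.
by apply: sumr_ge0 => k _; rewrite mulr_ge0// ltW// coef_gt0.
Qed.

Lemma coefD j k : coef (j + k) <= coef j * 2^-1 ^+ k.
Proof.
rewrite /coef /rad exprD mulrAC invfM exprMn ler_wpM2l ?exprn_ge0 ?invr_ge0 ?(ltW (rad_gt0 _))//.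
rewrite -exprVn -exprM mulnC exprM.
have h0 : 0 <= 2^-1 ^+ k :> R by rewrite exprn_ge0// invr_ge0.
have h1 : 2^-1 ^+ k <= 1 :> R by rewrite exprn_ile1// ?invr_ge0// invf_le1// ler1n.
by rewrite -[leRHS]expr1 -exprM mulnC exprM ler_wiXn2l.
Qed.

(** A geometric series. The factor [1 - 2^-1 ^+ (m - k)] lets the induction close; for [m <= k] the
    truncated subtraction makes it 0, like the sum. *)
Lemma sum_coef_le m k : \sum_(j < m | (k <= j)%N) coef j <= 2 * coef k * (1 - 2^-1 ^+ (m - k)).
Proof.
elim: m => [|m IH]; first by rewrite big_ord0 sub0n expr0 subrr mulr0.
rewrite big_mkcond big_ord_recr/= -big_mkcond/=.
have [km|mk] := leqP k m; last first.
  have e1 : (m.+1 - k = 0)%N by apply/eqP; rewrite subn_eq0.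
  have e2 : (m - k = 0)%N by apply/eqP; rewrite subn_eq0 ltnW.
  by rewrite addr0 (le_trans IH)// e1 e2.
have h : coef m <= coef k * 2^-1 ^+ (m - k) by rewrite -{1}(subnKC km) coefD.
rewrite subSn// exprS; lra.
Qed.

(** 3 is 1 for the leading constant plus 2 for the geometric series. *)
Lemma dyadic_weight_upper k y : (k <= 2 * M)%N ->
  (forall j, (j < k)%N -> ~ box n (rad j) y) -> dyadic_weight y <= 3 * coef k.
Proof.
move=> k2M hy.
have h1 : coef (2 * M) <= coef k by apply: coef_le; [exact: rad_gt0|exact: rad_le].
have h2 : \sum_(j < (2 * M).+1) coef j * \1_(box n (rad j)) y <=
    \sum_(j < (2 * M).+1 | (k <= j)%N) coef j.
  rewrite [leRHS]big_mkcond/=; apply: ler_sum => j _.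
  have [kj|jk] := leqP k j.
    by rewrite ler_piMr ?(ltW (coef_gt0 _))// indicE; case: (_ \in _).
  by rewrite indicE memNset ?mulr0//; exact: hy.
have h3 := le_trans h2 (sum_coef_le _ _).
have h4 : 2 * coef k * (1 - 2^-1 ^+ ((2 * M).+1 - k)) <= 2 * coef k.
  rewrite ler_piMr ?mulr_ge0 ?(ltW (coef_gt0 _))// gerBl exprn_ge0// invr_ge0//.
by rewrite /dyadic_weight; lra.
Qed.

Lemma dyadic_weight_far y : (forall j, (j <= 2 * M)%N -> ~ box n (rad j) y) -> dyadic_weight y = coef (2 * M).
Proof.
move=> hy; rewrite /dyadic_weight big1 ?addr0// => j _.
by rewrite indicE memNset ?mulr0//; apply: hy; rewrite -ltnS.
Qed.

Local Open Scope ereal_scope.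

Lemma integral_dyadic_weight (Q : set E) : measurable Q ->
  \int[mu]_(x in Q) (dyadic_weight x)%:E = (coef (2 * M))%:E * mu Q +
    \sum_(k < (2 * M).+1) (coef k)%:E * mu (box n (rad k) `&` Q).
Proof.
move=> mQ.
have mI (k : nat) : measurable_fun Q (fun x : E => (\1_(box n (rad k)) x)%:E : \bar R).
  by apply/measurable_EFinP; apply: measurable_indic; exact: measurable_box.
have c0 k : (0 <= coef k)%R by exact: ltW (coef_gt0 k).
under eq_integral do rewrite /dyadic_weight EFinD -sumEFin.
rewrite ge0_integralD//.
- rewrite integral_cst// ge0_integral_sum//.
  + congr (_ + _); apply: eq_bigr => k _.
    under eq_integral do rewrite EFinM.
    rewrite ge0_integralZl_EFin//.
    by rewrite integral_indic//; exact: measurable_box.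
  + by move=> k; under eq_fun do rewrite EFinM; apply: measurable_funeM; exact: mI.
  + by move=> k x _; rewrite lee_fin mulr_ge0.
- by move=> x _; rewrite lee_fin.
- by move=> x _; apply: sume_ge0 => k _; rewrite lee_fin mulr_ge0.
- by apply: emeasurable_sum => k; under eq_fun do rewrite EFinM; apply: measurable_funeM; exact: mI.
Qed.

(** The A_1 condition with a constant of order [M]. If the box of scale [k] meets the cube, then [y]
    lies in the box of radius [rad k + l], at most twice the larger of the two; the lower bound for
    the weight at [y] absorbs the summand up to [8 ^+ n]. There are [2 * M + 1] summands besides the
    leading constant. *)
Lemma dyadic_weight_A1 (a : E) (l : R) y : (0 < l)%R -> cube a l y ->
  \int[mu]_(x in cube a l) (dyadic_weight x)%:E <= (8 ^+ n * (2 * M).+2%:R * l ^+ n * dyadic_weight y)%:E.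
Proof.
move=> l0 Qy; have mQ := measurable_cube a l.
have ml : mu (cube a l) = (l ^+ n)%:E by apply: lebesgue_cube; exact: ltW.
have ln0 : (0 <= l ^+ n)%R by rewrite exprn_ge0// ltW.
have d0 := ltW (dyadic_weight_gt0 y).
rewrite integral_dyadic_weight//.
have term (k : nat) : (k < (2 * M).+1)%N ->
    (coef k)%:E * mu (box n (rad k) `&` cube a l) <= (8 ^+ n * l ^+ n * dyadic_weight y)%:E.
  move=> k2M; have rk0 := rad_gt0 k.
  have [->|/set0P[x [bx Qx]]] := eqVneq (box n (rad k) `&` cube a l) set0.
    by rewrite measure0 mule0 lee_fin !mulr_ge0// exprn_ge0.
  have yb : box n (rad k + l) y.
    apply/boxP => i; have := (boxP _ _).1 bx i.
    have := Qx i; have := Qy i; rewrite !ler_norml => /andP[? ?] /andP[? ?] /andP[? ?].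
    by apply/andP; split; lra.
  have mB : measurable (box n (rad k)) by exact: measurable_box.
  have mI : measurable (box n (rad k) `&` cube a l) by exact: measurableI.
  have [lk|kl] := leP l (rad k).
    apply: (@le_trans _ _ ((coef k)%:E * mu (cube a l))).
      rewrite lee_wpmul2l// ?lee_fin ?(ltW (coef_gt0 _))//.
      by apply: le_measure; rewrite ?inE.
    rewrite ml -EFinM lee_fin mulrAC ler_wpM2r//.
    have h : ((2 * (2 * rad k))^-1 ^+ n <= dyadic_weight y)%R.
      apply: dyadic_weight_lower; last by apply: subset_box yb; lra.
      by rewrite (le_trans (rad_le (leq0n k)))//; lra.
    apply: (@le_trans _ _ (8 ^+ n * (2 * (2 * rad k))^-1 ^+ n)%R); last first.
      by rewrite ler_wpM2l// exprn_ge0.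
    rewrite /coef -exprMn lerXn2r ?nnegrE ?mulr_ge0 ?invr_ge0 ?mulr_ge0 ?(ltW rk0)//.
    rewrite (_ : 8 * _ = 2 * (rad k)^-1)%R; last by field; rewrite gt_eqF.
    by have := rk0; rewrite -invr_gt0 => ?; lra.
  apply: (@le_trans _ _ ((coef k)%:E * mu (box n (rad k)))).
    rewrite lee_wpmul2l// ?lee_fin ?(ltW (coef_gt0 _))//.
    by apply: le_measure; rewrite ?inE.
  rewrite lebesgue_box ?(ltW rk0)// -EFinM lee_fin.
  rewrite /coef -exprMn mulrCA mulVf ?gt_eqF// mulr1.
  have h : ((2 * (2 * l))^-1 ^+ n <= dyadic_weight y)%R.
    apply: dyadic_weight_lower; last by apply: subset_box yb; lra.
    by rewrite (le_trans (rad_le (leq0n k)))//; lra.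
  apply: (@le_trans _ _ (8 ^+ n * l ^+ n * (2 * (2 * l))^-1 ^+ n)%R); last first.
    by rewrite ler_wpM2l// mulr_ge0// exprn_ge0.
  rewrite -!exprMn lerXn2r ?nnegrE//.
    by rewrite !mulr_ge0 ?invr_ge0 ?mulr_ge0// ltW.
  by rewrite (_ : 8 * l * _ = 2)%R//; field; rewrite gt_eqF.
have t0 : (coef (2 * M))%:E * mu (cube a l) <= (8 ^+ n * l ^+ n * dyadic_weight y)%:E.
  rewrite ml -EFinM lee_fin mulrC -mulrA [leRHS]mulrCA ler_wpM2l//.
  apply: (le_trans (dyadic_weight_ge_coef y)).
  by rewrite ler_peMl// exprn_ege1// ler1n.
have ts : \sum_(k < (2 * M).+1) (coef k)%:E * mu (box n (rad k) `&` cube a l)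
    <= ((2 * M).+1%:R * (8 ^+ n * l ^+ n * dyadic_weight y))%:E.
  apply: (@le_trans _ _ (\sum_(k < (2 * M).+1) (8 ^+ n * l ^+ n * dyadic_weight y)%:E)).
    by apply: lee_sum => k _; exact: term.
  by rewrite sumEFin sumr_const card_ord mulr_natl.
apply: (le_trans (leeD t0 ts)).
rewrite -EFinD lee_fin (_ : (2 * M).+2%:R = (2 * M).+1%:R + 1)%R; last by rewrite natr1.
by rewrite le_eqVlt; apply/orP; left; apply/eqP; ring.
Qed.

(** Over this box each summand, and likewise the leading constant, has integral [2 ^+ n]: the mass
    counts scales. The next bound counts the [M - m] scales below [2^-1 ^+ m]. *)
Lemma integral_dyadic_weight_box_le : \int[mu]_(x in box n (2 ^+ M)) (dyadic_weight x)%:E <=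
  (2 ^+ n * (2 * M).+2%:R)%:E.
Proof.
rewrite integral_dyadic_weight; last exact: measurable_box.
have r2M : rad (2 * M) = (2 ^+ M)%R by rewrite mul2n -addnn radDM.
have t k : (coef k)%:E * mu (box n (rad k)) = (2 ^+ n)%:E.
  rewrite lebesgue_box ?(ltW (rad_gt0 _))// -EFinM /coef -exprMn mulrCA.
  by rewrite mulVf ?gt_eqF ?rad_gt0// mulr1.
have ts : \sum_(k < (2 * M).+1) (coef k)%:E * mu (box n (rad k) `&` box n (2 ^+ M))
    <= ((2 * M).+1%:R * 2 ^+ n)%:E.
  apply: (@le_trans _ _ (\sum_(k < (2 * M).+1) (2 ^+ n)%:E)).
    apply: lee_sum => k _; rewrite -(t k) lee_wpmul2l// ?lee_fin ?(ltW (coef_gt0 _))//.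
    apply: le_measure; rewrite ?inE//; last exact: measurable_box.
    by apply: measurableI; exact: measurable_box.
  by rewrite sumEFin sumr_const card_ord mulr_natl.
rewrite -r2M t r2M in ts *.
apply: (le_trans (leeD (lexx _) ts)).
rewrite -EFinD lee_fin (_ : (2 * M).+2%:R = (2 * M).+1%:R + 1)%R; last by rewrite natr1.
by rewrite le_eqVlt; apply/orP; left; apply/eqP; ring.
Qed.

Lemma integral_dyadic_weight_box_ge m : (m <= M)%N ->
  (2 ^+ n * (M - m)%:R)%:E <= \int[mu]_(x in box n (2^-1 ^+ m)) (dyadic_weight x)%:E.
Proof.
move=> mM; rewrite integral_dyadic_weight; last exact: measurable_box.
have rm : rad (M - m) = (2^-1 ^+ m)%R.
  apply: (@mulfI _ (2 ^+ m)%R); first by rewrite expf_neq0.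
  rewrite -exprMn divff// expr1n /rad mulrA -exprD subnKC// divff//.
have t k : (coef k)%:E * mu (box n (rad k)) = (2 ^+ n)%:E.
  rewrite lebesgue_box ?(ltW (rad_gt0 _))// -EFinM /coef -exprMn mulrCA.
  by rewrite mulVf ?gt_eqF ?rad_gt0// mulr1.
have s0 : 0 <= (coef (2 * M))%:E * mu (box n (2^-1 ^+ m)).
  by rewrite mule_ge0// lee_fin ltW// coef_gt0.
apply: (@le_trans _ _ (\sum_(k < (2 * M).+1)
  (coef k)%:E * mu (box n (rad k) `&` box n (2^-1 ^+ m)))); last first.
  by rewrite leeDr.
have le2 : (M - m <= (2 * M).+1)%N by lia.
rewrite [leRHS](_ : _ = \sum_(0 <= k < (2 * M).+1)
  (coef k)%:E * mu (box n (rad k) `&` box n (2^-1 ^+ m))); last by rewrite big_mkord.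
rewrite (big_cat_nat _ le2)//=.
apply: (@le_trans _ _ (\sum_(0 <= k < M - m)
  (coef k)%:E * mu (box n (rad k) `&` box n (2^-1 ^+ m)))); last first.
  by rewrite leeDl// sume_ge0// => k _; rewrite mule_ge0// lee_fin ltW// coef_gt0.
rewrite big_mkord (eq_bigr (fun=> (2 ^+ n)%:E)) => [|k _].
  by rewrite sumEFin sumr_const card_ord mulr_natr.
rewrite setIidl ?t//; apply: subset_box; rewrite -rm; apply: rad_le.
exact: ltnW.
Qed.

End dyadic_weight.

(** * Muckenhoupt constants and operator norms *)

Section A1_weights.
Context (R : realType) (n : nat).
Local Notation E := (euclid R n).
Local Notation mu := (lebesgue R n).
Variables (p : R) (w : E -> R) (A delta : R).
Hypotheses (p1 : 1 < p) (mw : measurable_fun setT w) (A0 : 0 < A)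
  (delta0 : 0 < delta) (w_ge : forall x, delta <= w x)
  (wA1 : forall a l y, 0 < l -> cube a l y ->
     (\int[mu]_(x in cube a l) (w x)%:E <= (A * l ^+ n * w y)%:E)%E).

Let w_gt0 x : 0 < w x. Proof. exact: lt_le_trans delta0 (w_ge x). Qed.

Let pm1 : 0 < p - 1. Proof. by rewrite subr_gt0. Qed.

Let expE : 1 - conjugate_exponent p = - (p - 1)^-1.
Proof.
rewrite /conjugate_exponent; field.
by rewrite !gt_eqF ?subr_gt0 ?(lt_trans ltr01 p1)//.
Qed.

(** This is the dual weight of [w] for the conjugate exponent, so that its own [p]-dual weight is
    [w] again. *)
Definition dual_power (x : E) : R := w x `^ (1 - p).

Let expM : (1 - p) * (- (p - 1)^-1) = 1.
Proof. by field; rewrite gt_eqF. Qed.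

Lemma dual_weightE : dual_weight p w = EFin \o (fun x => w x `^ (- (p - 1)^-1)).
Proof. by apply/funext => x; rewrite /dual_weight gt_eqF// expE. Qed.

Lemma dual_dual_power : dual_weight p dual_power = EFin \o w.
Proof.
apply/funext => x; rewrite /dual_weight /dual_power gt_eqF ?powR_gt0//.
by rewrite expE -powRrM expM powRr1// ltW.
Qed.

Lemma powR_antitone (e x y : R) : e <= 0 -> 0 < x -> x <= y -> y `^ e <= x `^ e.
Proof.
move=> e0 x0 xy; have y0 : 0 < y by exact: lt_le_trans xy.
rewrite -[e]opprK !(powRN _ (- e)) lef_pV2 ?posrE ?powR_gt0//.
by rewrite ge0_ler_powR ?nnegrE ?oppr_ge0// ltW.
Qed.

(** [m] is the average of [w] over the cube divided by [A]. The A_1 hypothesis makes it a lower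
    bound for [w] there, and [delta] makes it positive. *)
Let cubeP (a : E) (l : R) : 0 < l -> exists m, [/\ 0 < m,
   (\int[mu]_(x in cube a l) (w x)%:E = (A * m * l ^+ n)%:E)%E &
   forall x, cube a l x -> m <= w x].
Proof.
move=> l0; have ln0 : 0 < l ^+ n by rewrite exprn_gt0.
have mQ := measurable_cube a l.
have Qa : cube a l a by move=> i; rewrite lexx lerDl ltW.
have I0 : (0 <= \int[mu]_(x in cube a l) (w x)%:E)%E.
  by apply: integral_ge0 => x _; rewrite lee_fin ltW.
have If : (\int[mu]_(x in cube a l) (w x)%:E)%E \is a fin_num.
  by rewrite ge0_fin_numE// (le_lt_trans (wA1 l0 Qa))// ltry.
have lb : ((delta * l ^+ n)%:E <= \int[mu]_(x in cube a l) (w x)%:E)%E.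
  have -> : ((delta * l ^+ n)%:E = \int[mu]_(x in cube a l) (cst delta%:E) x)%E.
    by rewrite integral_cst// EFinM -(lebesgue_cube a (ltW l0)).
  apply: ge0_le_integral => //.
  - by move=> x _; rewrite lee_fin ltW.
  - by apply/measurable_EFinP; exact: measurable_funTS.
  - by move=> x _; rewrite lee_fin.
move: wA1 => /(_ a l) wQ; rewrite -(fineK If) in wQ lb *.
set I := fine _ in wQ lb *.
exists (I / (A * l ^+ n)); split.
- rewrite divr_gt0 ?mulr_gt0// -lte_fin; apply: lt_le_trans lb.
  by rewrite lte_fin mulr_gt0.
- by congr EFin; field; rewrite !gt_eqF.
- move=> x Qx; rewrite ler_pdivrMr ?mulr_gt0// mulrC.
  by have := wQ x l0 Qx; rewrite lee_fin.
Qed.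

Let average_le (a : E) (l : R) (f : E -> R) (b : R) : 0 < l -> 0 <= b ->
  measurable_fun setT f -> (forall x, 0 <= f x) -> (forall x, cube a l x -> f x <= b) ->
  (average (cube a l) (EFin \o f) <= b%:E)%E.
Proof.
move=> l0 b0 mf f0 fb; have ln0 : 0 < l ^+ n by rewrite exprn_gt0.
have mQ := measurable_cube a l.
rewrite /average lebesgue_cube ?(ltW l0)//= -(@lee_pmul2l _ (l ^+ n)%:E)//.
rewrite muleA -EFinM divff ?gt_eqF// mul1e muleC.
have -> : (b%:E * (l ^+ n)%:E = \int[mu]_(x in cube a l) (cst b%:E) x)%E.
  by rewrite integral_cst// -(lebesgue_cube a (ltW l0)).
apply: ge0_le_integral => //.
- by move=> x _; rewrite lee_fin.
- by apply/measurable_EFinP; exact: measurable_funTS.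
Qed.

Let average_w (a : E) (l m : R) : 0 < l ->
  (\int[mu]_(x in cube a l) (w x)%:E = (A * m * l ^+ n)%:E)%E ->
  average (cube a l) (EFin \o w) = (A * m)%:E.
Proof.
move=> l0 I; rewrite /average lebesgue_cube ?(ltW l0)// [X in (_ * X)%E]I /= -EFinM.
by congr EFin; field; rewrite gt_eqF// exprn_gt0.
Qed.

Let measurable_pow e : measurable_fun setT (fun x => w x `^ e).
Proof. exact: (measurableT_comp (@measurable_powR R e)). Qed.

(** With [m] as in [cubeP], the averages are [A * m] and at most [m^(-1/(p-1))]; the power [p - 1]
    of the latter bound is [m^-1]. *)
Lemma Ap_A1 : weight w /\ (Ap_const p w <= A%:E)%E.
Proof.
split.
  split=> //; first by move=> x; exact: ltW.
  by move=> a l l0; have [m [_ -> _]] := cubeP a l0; rewrite ltry.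
apply: ge_ereal_sup => _ [a [l [l0 ->]]].
have [m [m0 I mw']] := cubeP a l0.
rewrite (average_w l0 I) dual_weightE.
have e0 : - (p - 1)^-1 <= 0 by rewrite oppr_le0 invr_ge0 ltW.
have av : (average (cube a l) (EFin \o (fun x => w x `^ (- (p - 1)^-1))%R) <=
    (m `^ (- (p - 1)^-1))%:E)%E.
  apply: average_le => //; first exact: powR_ge0.
    by move=> x; exact: powR_ge0.
  by move=> x Qx; apply: powR_antitone => //; exact: mw'.
apply: (@le_trans _ _ ((A * m)%:E * (m `^ (- (p - 1)^-1))%:E `^ (p - 1))%E).
  rewrite lee_wpmul2l// ?lee_fin ?mulr_ge0 ?(ltW A0) ?(ltW m0)//.
  apply: gt0_ler_poweR => //; first exact: ltW.
    rewrite in_itv/= leey andbT mule_ge0 ?lee_fin ?invr_ge0 ?fine_ge0//.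
    by apply: integral_ge0 => x _; rewrite lee_fin powR_ge0.
  by rewrite in_itv/= leey andbT lee_fin powR_ge0.
rewrite poweR_EFin -powRrM mulNr mulVf ?gt_eqF// powR_inv1 ?(ltW m0)// -EFinM.
by rewrite lee_fin mulfK// gt_eqF.
Qed.

(** The averages change roles: [m^(1-p)] bounds the first, and the second is exactly [A * m], raised
    to the power [p - 1]. *)
Lemma Ap_dual_A1 : weight dual_power /\ (Ap_const p dual_power <= (A `^ (p - 1))%:E)%E.
Proof.
have e0 : 1 - p <= 0 by rewrite subr_le0 ltW.
split.
  split=> //; first by move=> x; exact: powR_ge0.
  - exact: measurable_pow.
  - move=> a l l0; have [m [m0 _ mw']] := cubeP a l0.
    have mQ := measurable_cube a l.
    apply: (@le_lt_trans _ _ (\int[mu]_(x in cube a l) (cst (m `^ (1 - p))%:E) x)%E).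
      apply: ge0_le_integral => //.
      + by move=> x _; rewrite lee_fin powR_ge0.
      + by apply/measurable_EFinP; apply: measurable_funTS; exact: measurable_pow.
      + by move=> x Qx; rewrite lee_fin; apply: powR_antitone => //; exact: mw'.
    rewrite integral_cst//.
    by rewrite -[X in (_ * X)%E]/(mu (cube a l)) lebesgue_cube ?(ltW l0)// -EFinM ltry.
apply: ge_ereal_sup => _ [a [l [l0 ->]]].
have [m [m0 I mw']] := cubeP a l0.
rewrite dual_dual_power (average_w l0 I).
have av : (average (cube a l) (EFin \o dual_power) <= (m `^ (1 - p))%:E)%E.
  apply: average_le => //; first exact: powR_ge0.
  - exact: measurable_pow.
  - by move=> x; exact: powR_ge0.
  - by move=> x Qx; apply: powR_antitone => //; exact: mw'.
apply: (@le_trans _ _ ((m `^ (1 - p))%:E * (A * m)%:E `^ (p - 1))%E).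
  by rewrite lee_wpmul2r// poweR_ge0.
rewrite poweR_EFin powRM ?(ltW A0) ?(ltW m0)// -EFinM lee_fin.
rewrite mulrCA -powRD ?(gt_eqF m0) ?implybT// (_ : 1 - p + (p - 1) = 0); last by ring.
by rewrite powRr0 mulr1.
Qed.

End A1_weights.

(** * Bounds from below for constants and operator norms *)

Section Ap_constant.
Context (R : realType) (n : nat).
Local Notation E := (euclid R n).
Local Notation mu := (lebesgue R n).

(** A cube on which the weight is constant gives a product equal to 1, which spares Jensen's
    inequality. *)
Lemma Ap_const_ge1 (p v : R) (w : E -> R) (a : E) : 1 < p -> 0 < v ->
  (forall x, cube a 1 x -> w x = v) -> (1 <= Ap_const p w)%E.
Proof.
move=> p1 v0 wv; apply: ereal_sup_ubound; exists a, 1; split => //.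
have pm1 : 0 < p - 1 by rewrite subr_gt0.
have expE : 1 - conjugate_exponent p = - (p - 1)^-1.
  rewrite /conjugate_exponent; field.
  by rewrite !gt_eqF ?subr_gt0 ?(lt_trans ltr01 p1).
have avg (f : E -> \bar R) b : (forall x, cube a 1 x -> f x = b%:E) ->
    average (cube a 1) f = b%:E.
  move=> fb; rewrite /average lebesgue_cube// expr1n /= invr1 mul1e.
  transitivity (\int[mu]_(x in cube a 1) (cst b%:E x))%E.
    by apply: eq_integral => x; rewrite inE => /fb.
  rewrite integral_cst; last exact: measurable_cube.
  by rewrite -[X in (_ * X)%E]/(mu (cube a 1)) lebesgue_cube// expr1n mule1.
rewrite (avg _ v) => [|x /wv <-]//.
rewrite (avg _ (v `^ (- (p - 1)^-1))) => [|x Qx]; last first.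
  by rewrite /dual_weight (wv _ Qx) gt_eqF// expE.
rewrite poweR_EFin -powRrM mulNr mulVf ?gt_eqF// powR_inv1 ?(ltW v0)// -EFinM.
by rewrite divff// gt_eqF.
Qed.

(** [beta] may be negative. As [q >= 1], replacing it by its positive part only enlarges the power,
    which is then monotone in [q]. *)
Lemma poweR_bound (q : \bar R) (A beta : R) : (1 <= q)%E -> (q <= A%:E)%E ->
  (poweR q beta <= (A `^ Num.max beta 0)%:E)%E.
Proof.
case: q => [q| |]//; rewrite !lee_fin => q1 qA.
apply: (@le_trans _ _ (q `^ Num.max beta 0)).
  by apply: ler_powR => //; rewrite le_max lexx.
apply: ge0_ler_powR; rewrite ?nnegrE ?le_max ?lexx ?orbT//; lra.
Qed.

(** The integral of a non-negative function is the supremum over the simple functions below it,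
    hence monotone as it stands. It serves for images under the operator, whose measurability then
    need not be established. *)
Lemma ge0_le_integral_nonmeasurable d (T : measurableType d) (m : {measure set T -> \bar R})
    (f g : T -> \bar R) : (forall x, 0 <= f x)%E -> (forall x, f x <= g x)%E ->
  (\int[m]_x f x <= \int[m]_x g x)%E.
Proof.
move=> f0 fg; rewrite !ge0_integralTE//; last by move=> x; exact: le_trans (fg x).
apply: le_ereal_sup => _ [h hf <-]; exists h => // x.
exact: le_trans (hf x) (fg x).
Qed.

Lemma opnorm_ge (p L : R) (w : E -> R) (lam : R) (f : E -> R) : 0 < p -> 0 <= L ->
  measurable_fun setT f -> (forall y, 0 <= f y) ->
  (\int[mu]_y (f y)%:E < +oo)%E ->
  (\int[mu]_y (f y `^ p * w y)%:E <= 1)%E -> (forall y, 0 <= w y) ->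
  (L%:E <= \int[mu]_x (cabs (bochner_riesz lam (fun y => (f y)%:C%C) x) `^ p * w x)%:E)%E ->
  ((L `^ p^-1)%:E <= Lpw_opnorm p w (@bochner_riesz R n lam))%E.
Proof.
move=> p0 L0 mf f0 fi fw w0 LB.
have pV0 : 0 <= p^-1 by rewrite invr_ge0 ltW.
apply: (@le_trans _ _ (Lpw_norm p w (bochner_riesz lam (fun y => (f y)%:C%C)))); last first.
  apply: ereal_sup_ubound; exists (fun y => (f y)%:C%C) => //; split.
    exact: cintegrable_real.
  rewrite /Lpw_norm -(poweR1r p^-1).
  have -> : (\int[mu]_x (cabs ((f x)%:C%C) `^ p * w x)%:E = \int[mu]_y (f y `^ p * w y)%:E)%E.
    by apply: eq_integral => y _; rewrite /cabs /= expr0n/= addr0 sqrtr_sqr ger0_norm.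
  apply: gt0_ler_poweR => //; rewrite ?in_itv/= ?leey ?andbT//.
  by apply: integral_ge0 => y _; rewrite lee_fin mulr_ge0// powR_ge0.
rewrite /Lpw_norm -poweR_EFin; apply: gt0_ler_poweR => //; rewrite ?in_itv/= ?leey ?andbT//.
by apply: integral_ge0 => y _; rewrite lee_fin mulr_ge0// powR_ge0.
Qed.

Lemma Re_le_cabs (z : R[i]) : complex.Re z <= cabs z.
Proof.
case: z => a b; rewrite /cabs /=.
by rewrite (le_trans (ler_norm a))// -sqrtr_sqr ler_wsqrtr// lerDl sqr_ge0.
Qed.

Lemma br_kernel_sym (lam : R) (x y : E) : br_kernel lam (esub x y) = br_kernel lam (esub y x).
Proof.
apply: eq_Rintegral => xi _; congr (_ * _); rewrite -cosN; congr cos.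
by rewrite !edot_esub; ring.
Qed.

End Ap_constant.

(** * Test functions *)

Section disjoint_sums.
Context (R : realType) d (T : measurableType d) (m : {measure set T -> \bar R}).

Lemma sum_disjoint_indic J (A : 'I_J -> set T) (v : 'I_J -> R) (g : R) y :
  (forall i j, A i y -> A j y -> i = j) -> 0 <= g ->
  (forall i, A i y -> v i <= g) -> \sum_i v i * \1_(A i) y <= g.
Proof.
move=> disj g0 vg; have [[i Ai]|noA] := pselect (exists i, A i y); last first.
  rewrite big1// => i _; rewrite indicE memNset ?mulr0// => Ai.
  by apply: noA; exists i.
rewrite (bigD1 i)//= big1 => [|j ji]; last first.
  rewrite indicE memNset ?mulr0// => Aj.
  by move: ji; rewrite (disj _ _ Aj Ai) eqxx.
by rewrite addr0 indicE mem_set// mulr1 vg.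
Qed.

Lemma integral_disjoint_ge J (A : 'I_J -> set T) (v : 'I_J -> R) (h : T -> R) (t : R) :
  (forall i, measurable (A i)) -> (forall i j y, A i y -> A j y -> i = j) ->
  (forall i, 0 <= v i) -> (forall y, 0 <= h y) ->
  (forall i y, A i y -> v i <= h y) ->
  (forall i, (t%:E <= (v i)%:E * m (A i))%E) ->
  ((J%:R * t)%:E <= \int[m]_y (h y)%:E)%E.
Proof.
move=> mA disj v0 h0 vh tv.
apply: (@le_trans _ _ (\int[m]_y (\sum_i v i * \1_(A i) y)%:E)%E); last first.
  apply: ge0_le_integral_nonmeasurable => y; rewrite lee_fin.
    by apply: sumr_ge0 => i _; rewrite mulr_ge0.
  by apply: sum_disjoint_indic => // [i j|i]; [exact: disj|exact: vh].
under eq_integral do rewrite -sumEFin.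
rewrite ge0_integral_sum//; last 2 first.
- move=> i; apply/measurable_EFinP; apply: measurable_funM; first exact: measurable_cst.
  exact: measurable_indic.
- by move=> i y _; rewrite lee_fin mulr_ge0.
apply: (@le_trans _ _ (\sum_(i < J) t%:E)%E).
  by rewrite sumEFin sumr_const card_ord mulr_natl.
apply: lee_sum => i _; apply: (le_trans (tv i)).
under eq_integral do rewrite EFinM.
rewrite ge0_integralZl_EFin//.
  by rewrite integral_indic// setIT.
by apply/measurable_EFinP; exact: measurable_indic.
Qed.

Lemma integral_indic_mul (D : set T) (f : T -> R) : measurable D ->
  (\int[m]_x (\1_D x * f x)%:E = \int[m]_(x in D) (f x)%:E)%E.
Proof.
move=> mD; rewrite [RHS]integral_mkcond; apply: eq_integral => x _.
by rewrite patchE indicE; case: ifP => _; rewrite ?mul1r ?mul0r.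
Qed.

End disjoint_sums.

(** * Linear growth against a power *)

Section growth.
Context (R : realType).

(** If [e < 1], dividing by [M^e] would bound [M^(1 - e)] for all large [M]; [X] is the point where
    this power exceeds that bound by 1. *)
Lemma linear_growth (b C K e : R) (M0 : nat) : 0 < b -> 0 <= C -> 0 < K ->
  (forall M : nat, (M0 <= M)%N -> b * M%:R <= C * (K * M%:R) `^ e) -> 1 <= e.
Proof.
move=> b0 C0 K0 h; rewrite leNgt; apply/negP => e1.
have e1' : 0 < 1 - e by rewrite subr_gt0.
pose X := (C * K `^ e / b + 1) `^ (1 - e)^-1.
have Y0 : 0 < C * K `^ e / b + 1.
  by rewrite ltr_wpDl// divr_ge0// ?mulr_ge0 ?powR_ge0// ltW.
have X0 : 0 < X by rewrite powR_gt0.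
pose M := (maxn M0 (Num.truncn X).+1)%N.
have XM : X < M%:R.
  by rewrite (lt_le_trans (truncnS_gt X))// ler_nat leq_maxr.
have Mp : 0 < M%:R :> R by exact: lt_trans XM.
have := h M (leq_maxl _ _); rewrite powRM ?(ltW K0) ?(ltW Mp)// => hM.
have hM2 : M%:R `^ (1 - e) <= C * K `^ e / b.
  rewrite ler_pdivlMr// -(@ler_pM2r _ (M%:R `^ e)) ?powR_gt0//.
  rewrite mulrAC -powRD ?(gt_eqF Mp) ?implybT// subrK powRr1 ?(ltW Mp)//.
  by rewrite mulrC -mulrA.
have : C * K `^ e / b + 1 <= M%:R `^ (1 - e).
  rewrite [leLHS](_ : _ = X `^ (1 - e)).
    by apply: ge0_ler_powR; rewrite ?nnegrE ?(ltW X0) ?(ltW Mp) ?(ltW e1') ?(ltW XM).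
  by rewrite /X -powRrM mulVf ?gt_eqF// powRr1// ltW.
lra.
Qed.

Lemma opnorm_arith (p a b q x D : R) : 0 < p -> 0 <= a -> 0 <= b -> 0 < D -> 0 <= x ->
  ((D^-1 * (a * x) `^ p) * b) `^ p^-1 = a * (b / D) `^ p^-1 * x.
Proof.
move=> p0 a0 b0 D0 x0.
have -> : D^-1 * (a * x) `^ p * b = (b / D) * (a * x) `^ p by ring.
rewrite (@powRM _ (b / D)) ?powR_ge0 ?divr_ge0 ?(ltW D0)//.
rewrite -powRrM divff ?gt_eqF// powRr1 ?mulr_ge0//; ring.
Qed.

End growth.

(** * Muckenhoupt constants of the dyadic weight and its dual *)

Section dyadic_Ap.
Context (R : realType) (n : nat) (p : R).
Hypotheses (n0 : (0 < n)%N) (p1 : 1 < p).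
Variable M : nat.
Local Notation w := (@dyadic_weight R n M).
Local Notation A := (8 ^+ n * (2 * M).+2%:R : R).

Let A_gt0 : 0 < A. Proof. by rewrite mulr_gt0// exprn_gt0. Qed.

Let wA1 a l y : 0 < l -> cube a l y ->
  (\int[lebesgue R n]_(x in cube a l) (w x)%:E <= (A * l ^+ n * w y)%:E)%E.
Proof. exact: dyadic_weight_A1. Qed.

(** The corner of a unit cube outside the largest box; there the weight is its leading constant, so
    the Muckenhoupt constant is at least 1. *)
Let far : euclid R n := [tuple 2 ^+ M + 1 | i < n].

Let dyadic_weight_far_cube x : cube far 1 x -> w x = coef R n M (2 * M).
Proof.
move=> Qx; apply: dyadic_weight_far => j j2M /boxP /(_ (Ordinal n0)).
have /andP[h _] := Qx (Ordinal n0); rewrite tnth_mktuple in h.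
have r2 : rad R M (2 * M) = 2 ^+ M by rewrite mul2n -addnn radDM.
have := rad_le R M j2M; rewrite r2 => hr hx.
have := ler_norm (tnth x (Ordinal n0)); lra.
Qed.

Lemma Ap_dyadic_weight : [/\ Ap p w, (1 <= Ap_const p w)%E & (Ap_const p w <= A%:E)%E].
Proof.
have [ww wA] := Ap_A1 p1 (measurable_dyadic_weight M) A_gt0 (coef_gt0 _ _ _ _) (dyadic_weight_ge_coef M) wA1.
split=> //; first by split=> //; exact: le_lt_trans wA (ltry _).
by apply: (Ap_const_ge1 p1 (coef_gt0 _ _ _ _)); exact: dyadic_weight_far_cube.
Qed.

Lemma Ap_dual_dyadic_weight : let v := dual_power p w in
  [/\ Ap p v, (1 <= Ap_const p v)%E & (Ap_const p v <= (A `^ (p - 1))%:E)%E].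
Proof.
move=> v.
have [ww wA] := Ap_dual_A1 p1 (measurable_dyadic_weight M) A_gt0 (coef_gt0 _ _ _ _) (dyadic_weight_ge_coef M) wA1.
split=> //; first by split=> //; exact: le_lt_trans wA (ltry _).
apply: (@Ap_const_ge1 _ _ _ (coef R n M (2 * M) `^ (1 - p)) _ far p1).
  by rewrite powR_gt0// coef_gt0.
by move=> x Qx; rewrite /v /dual_power dyadic_weight_far_cube.
Qed.

End dyadic_Ap.

(** * Lower bounds for the two operator norms *)

Section tests.
Context (R : realType) (n : nat) (p : R).
Hypotheses (n0 : (0 < n)%N) (p1 : 1 < p).
Local Notation N := n.+1.
Local Notation E := (euclid R N).
Local Notation mu := (lebesgue R N).
Local Notation lam := (n%:R / 2 : R).
Local Notation rho k := (2 ^+ k : R).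
Variables (c c1 rho0 : R) (k0 m0 : nat).
Hypotheses (c_gt0 : 0 < c) (c1_gt0 : 0 < c1) (rho0_ge8 : 8 <= rho0)
  (k0P : rho0 <= rho k0) (m0P : 80 * N%:R * 2^-1 ^+ m0 <= 1 :> R).
Hypothesis br_kernel_lower : forall r kappa x y, rho0 <= r -> 0 <= kappa ->
  80 * N%:R * kappa <= 1 -> good r y -> box N kappa x ->
  c * r^-1 ^+ N <= br_kernel lam (esub x y).
Hypothesis good_lower : forall r, 8 <= r ->
  ((c1 * r ^+ N)%:E <= mu (good r))%E.
Variable M : nat.
Hypotheses (k0M : (2 * k0 <= M)%N) (m0M : (2 * m0 <= M)%N) (M1 : (1 <= M)%N).
Local Notation w := (@dyadic_weight R N M).
Local Notation J := (M.+1 - k0)%N.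
Local Notation small := (box N (2^-1 ^+ m0 : R)).

(** The bound for the mass of [w] on the box of radius [2^M], which contains the supports of both
    test functions; it bounds the [p]-th powers of their norms before normalization. *)
Let D : R := 2 ^+ N * (2 * M).+2%:R.
(* Normalizes the test functions in the weighted norm. *)
Let s : R := D^-1 `^ p^-1.

Let lam_gt0 : 0 < lam. Proof. by rewrite divr_gt0// ltr0n. Qed.
Let p_gt0 : 0 < p. Proof. exact: lt_trans p1. Qed.
Let D_gt0 : 0 < D. Proof. by rewrite mulr_gt0// exprn_gt0. Qed.
Let s_ge0 : 0 <= s. Proof. exact: powR_ge0. Qed.
Let s_pow : s `^ p = D^-1.
Proof. by rewrite /s -powRrM mulVf ?gt_eqF// powRr1// invr_ge0 ltW. Qed.

Let shell (i : 'I_J) : set E := good (rho (k0 + i)).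

Let rho_ge (i : 'I_J) : rho0 <= rho (k0 + i).
Proof. by rewrite (le_trans k0P)// ler_weXn2l ?ler1n// leq_addr. Qed.

Let shell_le (i : 'I_J) : (k0 + i <= M)%N.
Proof. by case: i => i /= h; clear -h; lia. Qed.

Let measurable_shell (i : 'I_J) : measurable (shell i). Proof. exact: measurable_good. Qed.

Let shell_box i : shell i `<=` box N (rho M).
Proof.
move=> y /good_sub_box h; apply: subset_box (h _); last by rewrite exprn_gt0.
by rewrite ler_weXn2l ?ler1n.
Qed.

(** First coordinates in [good rho] lie in []rho / 2, rho]], and these intervals are disjoint for
    distinct powers of 2. *)
Let shell_lt (i j : 'I_J) y : (i < j)%N -> shell i y -> shell j y -> False.
Proof.
move=> ij [_ h1 _ _] [h2 _ _ _].
have : rho (k0 + i) <= rho (k0 + j) / 2.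
  rewrite ler_pdivlMr// -exprSr ler_weXn2l ?ler1n//.
  by rewrite -addnS leq_add2l.
by move=> h; have := lt_le_trans h2 (le_trans h1 h); rewrite ltxx.
Qed.

Let shell_disjoint (i j : 'I_J) y : shell i y -> shell j y -> i = j.
Proof.
move=> hi hj; apply: val_inj; case: (ltngtP i j) => // ij.
  by case: (shell_lt ij hi hj).
by case: (shell_lt ij hj hi).
Qed.

Let br_kernel_shell i x y : shell i y -> small x ->
  c * (rho (k0 + i))^-1 ^+ N <= br_kernel lam (esub x y).
Proof. by move=> yi xs; apply: br_kernel_lower m0P yi xs => //; rewrite exprn_ge0// invr_ge0. Qed.

Let shell_measure (i : 'I_J) : ((c1 * rho (k0 + i) ^+ N)%:E <= mu (shell i))%E.
Proof. by apply: good_lower; exact: le_trans (rho_ge i). Qed.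

Let small_sub : small `<=` box N (rho M).
Proof.
apply: subset_box; apply: (@le_trans _ _ 1).
  by rewrite exprn_ile1// ?invr_ge0// invf_le1// ler1n.
by rewrite exprn_ege1// ler1n.
Qed.

Let measurable_small : measurable small. Proof. exact: measurable_box. Qed.

Let integral_w_le (B : set E) : measurable B -> B `<=` box N (rho M) ->
  (\int[mu]_(x in B) (w x)%:E <= D%:E)%E.
Proof.
move=> mB Bs; apply: le_trans (integral_dyadic_weight_box_le _ _ _).
apply: ge0_subset_integral => //; first exact: measurable_box.
  by apply/measurable_EFinP; apply: measurable_funTS; exact: measurable_dyadic_weight.
by move=> x _; rewrite lee_fin ltW// dyadic_weight_gt0.
Qed.

Let integral_w_ge : ((2 ^+ N * (M - m0)%:R)%:E <= \int[mu]_(x in small) (w x)%:E)%E.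
Proof. by apply: integral_dyadic_weight_box_ge => //; clear -m0M; lia. Qed.

Let M_half m : (2 * m <= M)%N -> M%:R / 2 <= (M - m)%:R :> R.
Proof.
move=> h; rewrite ler_pdivrMr// -natrM ler_nat; clear -h; lia.
Qed.

Let D_le : D <= 2 ^+ N * 4 * M%:R.
Proof.
rewrite /D -mulrA ler_wpM2l ?exprn_ge0// -natrM ler_nat; clear -M1; lia.
Qed.

(** The quotient [M%:R / D] is bounded below, so after the [p]-th root only the factor [a * M%:R]
    grows with [M]. *)
Let opnorm_lower (v : E -> R) (f : E -> R) (a b : R) : 0 <= a -> 0 <= b ->
  measurable_fun setT f -> (forall y, 0 <= f y) ->
  (\int[mu]_y (f y)%:E < +oo)%E ->
  (\int[mu]_y (f y `^ p * v y)%:E <= 1)%E -> (forall y, 0 <= v y) ->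
  (((D^-1 * (a * M%:R) `^ p) * (b * M%:R))%:E <= \int[mu]_x
     (cabs (bochner_riesz lam (fun y => (f y)%:C%C) x) `^ p * v x)%:E)%E ->
  ((a * (b / (2 ^+ N * 4)) `^ p^-1 * M%:R)%:E <=
     Lpw_opnorm p v (@bochner_riesz R N lam))%E.
Proof.
move=> a0 b0 mf f0 fi fv v0 h.
have M0 : 0 < M%:R :> R by rewrite ltr0n.
have d0 : 0 < 2 ^+ N * 4 :> R by rewrite mulr_gt0// exprn_gt0.
rewrite -opnorm_arith//.
apply: (opnorm_ge p_gt0) mf f0 fi fv v0 _.
  by rewrite !mulr_ge0 ?powR_ge0 ?invr_ge0// ltW.
apply: le_trans h; rewrite lee_fin.
rewrite [leRHS](_ : _ = (a * M%:R) `^ p * (b * (M%:R / D))); last by ring.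
rewrite mulrAC [leLHS]mulrC ler_wpM2l ?powR_ge0// mulrC ler_wpM2l//.
by rewrite ler_pdivlMr// mulrC ler_pdivrMr// mulrC.
Qed.

(** On the small box each shell contributes at least [s * c * c1], since the decay of the kernel and
    the measure of the shell cancel; there are at least [M / 2] shells. The small box has mass of
    order [M] for [w], which makes up for the normalization by [D]. *)
Lemma opnorm_dyadic_weight : ((c * c1 / 2 * (2 ^+ N / 2 / (2 ^+ N * 4)) `^ p^-1 * M%:R)%:E <=
  Lpw_opnorm p w (@bochner_riesz R N lam))%E.
Proof.
pose G : set E := \bigcup_(i in setT) shell i.
have mG : measurable G by apply: fin_bigcup_measurable => // i _; exact: measurable_shell.
have Gb : G `<=` box N (rho M) by move=> y [i _]; exact: shell_box.
pose f (y : E) : R := s * \1_G y.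
have mf : measurable_fun setT f.
  by apply: measurable_funM; [exact: measurable_cst|exact: measurable_indic].
have f0 y : 0 <= f y by rewrite mulr_ge0.
have fi : (\int[mu]_y (f y)%:E < +oo)%E.
  under eq_integral do rewrite /f EFinM.
  rewrite ge0_integralZl_EFin//; last by apply/measurable_EFinP; exact: measurable_indic.
  rewrite integral_indic// setIT.
  apply: (@le_lt_trans _ _ (s%:E * mu (box N (rho M)))%E).
    rewrite lee_wpmul2l ?lee_fin//; apply: le_measure; rewrite ?inE//.
    exact: measurable_box.
  by rewrite lebesgue_box ?exprn_ge0// -EFinM ltry.
have fw : (\int[mu]_y (f y `^ p * w y)%:E <= 1)%E.
  have -> : (\int[mu]_y (f y `^ p * w y)%:E = \int[mu]_y (D^-1%:E * (\1_G y * w y)%:E))%E.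
    apply: eq_integral => y _; rewrite -EFinM /f powRM// s_pow -mulrA indicE.
    by case: (y \in G); rewrite ?powR1 ?powR0 ?gt_eqF.
  rewrite ge0_integralZl_EFin//; last 3 first.
  - by move=> y _; rewrite lee_fin mulr_ge0// ltW// dyadic_weight_gt0.
  - apply/measurable_EFinP; apply: measurable_funM; first exact: measurable_indic.
    exact: measurable_dyadic_weight.
  - by rewrite invr_ge0 ltW.
  rewrite integral_indic_mul//.
  apply: (@le_trans _ _ (D^-1%:E * D%:E)%E).
    by rewrite lee_wpmul2l ?lee_fin ?invr_ge0 ?(ltW D_gt0)// integral_w_le.
  by rewrite -EFinM mulVf// gt_eqF.
have w0 y : 0 <= w y by rewrite ltW// dyadic_weight_gt0.
have M0 : 0 <= M%:R :> R by [].
have a0 : 0 <= c * c1 / 2 by rewrite !mulr_ge0// ltW.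
have br_kernel0 x y : small x -> 0 <= f y * br_kernel lam (esub x y).
  move=> xs; rewrite /f indicE; case: (boolP (y \in G)) => [|_]; last by rewrite mulr0 mul0r.
  rewrite inE => -[i _ yi]; rewrite mulr1 mulr_ge0//.
  apply: le_trans (br_kernel_shell yi xs).
  by rewrite mulr_ge0 ?(ltW c_gt0)// exprn_ge0// invr_ge0 exprn_ge0.
have Bf x : small x ->
    s * (c * c1 / 2 * M%:R) <= complex.Re (bochner_riesz lam (fun y => (f y)%:C%C) x).
  move=> xs; rewrite -lee_fin -(integral_kernel lam_gt0 mf f0 fi x).
  apply: (@le_trans _ _ (J%:R * (s * c * c1))%:E).
    rewrite lee_fin.
    have h : M%:R / 2 <= J%:R :> R.
      by apply: (le_trans (M_half k0M)); rewrite ler_nat leq_sub2r.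
    have : 0 <= s * c * c1 by rewrite !mulr_ge0// ltW.
    nra.
  apply: (@integral_disjoint_ge _ _ _ mu J shell
    (fun i => s * (c * (rho (k0 + i))^-1 ^+ N))) => //.
  - by move=> i; rewrite !mulr_ge0 ?(ltW c_gt0)// exprn_ge0// invr_ge0 exprn_ge0.
  - by move=> y; exact: br_kernel0.
  - move=> i y yi; rewrite /f indicE mem_set; last by exists i.
    by rewrite mulr1 ler_wpM2l// br_kernel_shell.
  - move=> i; have r0 : 0 < rho (k0 + i) by rewrite exprn_gt0.
    have t0 : 0 <= s * (c * (rho (k0 + i))^-1 ^+ N).
      by rewrite !mulr_ge0 ?(ltW c_gt0)// exprn_ge0// invr_ge0 ltW.
    apply: (@le_trans _ _ ((s * (c * (rho (k0 + i))^-1 ^+ N))%:E * (c1 * rho (k0 + i) ^+ N)%:E)%E).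
      rewrite -EFinM lee_fin le_eqVlt; apply/orP; left; apply/eqP.
      by rewrite exprVn; field; rewrite expf_neq0// gt_eqF.
    by rewrite lee_wpmul2l ?lee_fin//; exact: shell_measure.
apply: (opnorm_lower a0 _ mf f0 fi fw w0); first by rewrite divr_ge0// exprn_ge0.
have T0 : 0 <= D^-1 * (c * c1 / 2 * M%:R) `^ p by rewrite mulr_ge0 ?powR_ge0// invr_ge0 ltW.
apply: (@le_trans _ _ ((D^-1 * (c * c1 / 2 * M%:R) `^ p)%:E * \int[mu]_(x in small) (w x)%:E)%E).
  rewrite EFinM lee_wpmul2l ?lee_fin//; apply: le_trans integral_w_ge.
  by rewrite lee_fin -mulrA ler_wpM2l ?exprn_ge0// mulrC M_half.
rewrite -integral_indic_mul// -ge0_integralZl_EFin//; last 2 first.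
- by move=> y _; rewrite lee_fin mulr_ge0.
- apply/measurable_EFinP; apply: measurable_funM; first exact: measurable_indic.
  exact: measurable_dyadic_weight.
apply: ge0_le_integral_nonmeasurable => x; rewrite -EFinM lee_fin.
  by rewrite !mulr_ge0 ?powR_ge0 ?invr_ge0// ltW.
rewrite indicE; case: (boolP (x \in small)) => [|_]; last first.
  by rewrite mul0r mulr0 mulr_ge0 ?powR_ge0.
rewrite inE mul1r => xs; rewrite ler_wpM2r//.
have h0 : 0 <= s * (c * c1 / 2 * M%:R) by rewrite mulr_ge0// mulr_ge0.
have h1 := le_trans (Bf x xs) (Re_le_cabs _).
rewrite -s_pow -powRM// ?(mulr_ge0 a0 M0)//.
by apply: ge0_ler_powR; rewrite ?nnegrE ?(ltW p_gt0)//; exact: le_trans h1.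
Qed.

(** [f^p * w^(1-p)] is a multiple of [w] on the small box because [p + (1 - p) = 1]. On a shell of
    radius [rho] the image is at least of size [s * M * rho^-N], and [rho^(-N p) * rho^(-N (1-p))]
    times the measure of the shell is of constant order: every shell counts the same. *)
Lemma opnorm_dual_dyadic_weight :
  ((c * 2 ^+ N / 2 * (3 `^ (1 - p) * c1 / 2 / (2 ^+ N * 4)) `^ p^-1 * M%:R)%:E <=
  Lpw_opnorm p (dual_power p w) (@bochner_riesz R N lam))%E.
Proof.
pose f (y : E) : R := s * (\1_small y * w y).
have w_gt0 y : 0 < w y by exact: dyadic_weight_gt0.
have w0 y : 0 <= w y by exact: ltW.
have miw : measurable_fun setT (fun y => \1_small y * w y).
  by apply: measurable_funM; [exact: measurable_indic|exact: measurable_dyadic_weight].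
have mf : measurable_fun setT f by apply: measurable_funM => //; exact: measurable_cst.
have f0 y : 0 <= f y by rewrite !mulr_ge0.
have fi : (\int[mu]_y (f y)%:E < +oo)%E.
  under eq_integral do rewrite /f EFinM.
  rewrite ge0_integralZl_EFin//; last 2 first.
  - by move=> y _; rewrite lee_fin mulr_ge0.
  - exact/measurable_EFinP.
  rewrite integral_indic_mul//.
  apply: (@le_lt_trans _ _ (s%:E * D%:E)%E); last by rewrite -EFinM ltry.
  by rewrite lee_wpmul2l ?lee_fin// integral_w_le.
have v0 y : 0 <= dual_power p w y by exact: powR_ge0.
have fw : (\int[mu]_y (f y `^ p * dual_power p w y)%:E <= 1)%E.
  have -> : (\int[mu]_y (f y `^ p * dual_power p w y)%:E =
      \int[mu]_y (D^-1%:E * (\1_small y * w y)%:E))%E.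
    apply: eq_integral => y _; rewrite -EFinM /f powRM ?mulr_ge0// s_pow -mulrA indicE.
    case: (y \in small); last by rewrite !mul0r powR0 ?mul0r// gt_eqF.
    rewrite !mul1r /dual_power -powRD; last by rewrite (gt_eqF (w_gt0 y)) implybT.
    by rewrite (_ : p + (1 - p) = 1) ?powRr1//; ring.
  rewrite ge0_integralZl_EFin//; last 3 first.
  - by move=> y _; rewrite lee_fin mulr_ge0.
  - exact/measurable_EFinP.
  - by rewrite invr_ge0 ltW.
  rewrite integral_indic_mul//.
  apply: (@le_trans _ _ (D^-1%:E * D%:E)%E).
    by rewrite lee_wpmul2l ?lee_fin ?invr_ge0 ?(ltW D_gt0)// integral_w_le.
  by rewrite -EFinM mulVf// gt_eqF.
have M0 : 0 <= M%:R :> R by [].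
have a0 : 0 <= c * 2 ^+ N / 2 by rewrite !mulr_ge0// ?exprn_ge0// ltW.
have b0 : 0 <= 3 `^ (1 - p) * c1 / 2 by rewrite !mulr_ge0 ?powR_ge0// ltW.
have Bf i x : shell i x -> s * (c * 2 ^+ N / 2 * M%:R) * (rho (k0 + i))^-1 ^+ N <=
    complex.Re (bochner_riesz lam (fun y => (f y)%:C%C) x).
  move=> xi; rewrite -lee_fin -(integral_kernel lam_gt0 mf f0 fi x).
  set r := (rho (k0 + i))^-1 ^+ N.
  have r0 : 0 <= r by rewrite exprn_ge0// invr_ge0 exprn_ge0.
  apply: (@le_trans _ _ (\int[mu]_y ((s * (c * r))%:E * (\1_small y * w y)%:E))%E).
    rewrite ge0_integralZl_EFin//; last 3 first.
    - by move=> y _; rewrite lee_fin mulr_ge0.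
    - exact/measurable_EFinP.
    - by rewrite !mulr_ge0// ltW.
    rewrite integral_indic_mul//.
    apply: (@le_trans _ _ ((s * (c * r))%:E * (2 ^+ N * (M - m0)%:R)%:E)%E).
      rewrite -EFinM lee_fin.
      rewrite (_ : _ * r = s * (c * r) * (2 ^+ N * (M%:R / 2))); last by field.
      by rewrite ler_wpM2l ?mulr_ge0 ?(ltW c_gt0)// ler_wpM2l ?exprn_ge0// M_half.
    by rewrite lee_wpmul2l ?lee_fin ?mulr_ge0// ltW.
  apply: ge0_le_integral_nonmeasurable => y; rewrite -EFinM lee_fin.
    by rewrite !mulr_ge0// ltW.
  rewrite /f -[leLHS]mulrA -[leRHS]mulrA ler_wpM2l//.
  rewrite indicE; case: (boolP (y \in small)) => [|_]; last by rewrite !mul0r !mulr0.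
  rewrite inE mul1r => ys.
  (* The kernel is symmetric; now the evaluation point lies in the shell and the integration
     variable in the small box. *)
  by rewrite [leLHS]mulrC ler_wpM2l// br_kernel_sym; exact: br_kernel_shell.
apply: (opnorm_lower a0 b0 mf f0 fi fw v0).
set X := c * 2 ^+ N / 2 * M%:R.
have X0 : 0 <= X by rewrite mulr_ge0.
apply: (@le_trans _ _ (J%:R * ((D^-1 * X `^ p) * (3 `^ (1 - p) * c1)))%:E).
  rewrite lee_fin.
  have h : M%:R / 2 <= J%:R :> R.
    by apply: (le_trans (M_half k0M)); rewrite ler_nat leq_sub2r.
  have Y0 : 0 <= D^-1 * X `^ p by rewrite mulr_ge0 ?powR_ge0// invr_ge0 ltW.
  have Z0 : 0 <= 3 `^ (1 - p) * c1 by rewrite mulr_ge0 ?powR_ge0// ltW.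
  move: (D^-1 * _) (3 `^ _ * _) Y0 Z0 => Y Z Y0 Z0.
  rewrite (_ : Y * _ = M%:R / 2 * (Y * Z)); last by field.
  by rewrite ler_wpM2r// mulr_ge0.
pose r i : R := (rho (k0 + i))^-1 ^+ N.
have r_gt0 i : 0 < r i by rewrite exprn_gt0// invr_gt0 exprn_gt0.
apply: (@integral_disjoint_ge _ _ _ mu J shell
    (fun i => (s * X * r i) `^ p * (3 * r i) `^ (1 - p))) => //.
- by move=> i; rewrite mulr_ge0 ?powR_ge0.
- by move=> y; rewrite mulr_ge0 ?powR_ge0.
- move=> i y yi; apply: ler_pM; rewrite ?powR_ge0//.
    have h0 : 0 <= s * X * r i by rewrite !mulr_ge0// ltW.
    have h1 := le_trans (Bf i y yi) (Re_le_cabs _).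
    by apply: ge0_ler_powR; rewrite ?nnegrE ?(ltW p_gt0)//; exact: le_trans h1.
  (* A point of the shell lies outside all boxes of index below [M + (k0 + i)], which bounds the
     weight from above; the exponent [1 - p] is negative and turns this into a bound from below. *)
  apply: powR_antitone => //; first by rewrite subr_le0 ltW.
  have -> : r i = coef R N M (M + (k0 + i)) by rewrite /r /coef radDM.
  apply: dyadic_weight_upper => //; first by have h := shell_le i; clear -h; lia.
  move=> j hj; apply: good_not_box yi.
  rewrite ler_pdivlMr// -(radDM R M) mulrC -radS.
  exact: rad_le.
- move=> i; rewrite /shell.
  apply: (@le_trans _ _ (((s * X * r i) `^ p * (3 * r i) `^ (1 - p))%:E *
    (c1 * rho (k0 + i) ^+ N)%:E)%E); last first.
    by rewrite lee_wpmul2l ?lee_fin ?mulr_ge0 ?powR_ge0//; exact: shell_measure.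
  rewrite -EFinM lee_fin le_eqVlt; apply/orP; left; apply/eqP.
  have ri0 := ltW (r_gt0 i).
  have e1 : (s * X * r i) `^ p = D^-1 * X `^ p * r i `^ p.
    by rewrite powRM ?(mulr_ge0 s_ge0 X0)// [in LHS]powRM// s_pow.
  have e3 : (3 * r i) `^ (1 - p) = 3 `^ (1 - p) * r i `^ (1 - p) by rewrite powRM.
  rewrite e1 e3.
  have e : (r i) `^ p * (r i) `^ (1 - p) = r i.
    rewrite -powRD; last by rewrite (gt_eqF (r_gt0 i)) implybT.
    by rewrite (_ : p + (1 - p) = 1) ?powRr1//; ring.
  have e2 : r i * rho (k0 + i) ^+ N = 1.
    by rewrite /r exprVn mulVf// expf_neq0// expf_neq0.
  rewrite (_ : _ * (c1 * _) = D^-1 * X `^ p * (3 `^ (1 - p) * c1) *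
    ((r i `^ p * r i `^ (1 - p)) * rho (k0 + i) ^+ N)); last by ring.
  by rewrite e e2 mulr1.
Qed.

End tests.

(** * Comparison of the growth rates *)

Section sharpness.
Context (R : realType) (n : nat) (p beta : R).
Hypotheses (n0 : (0 < n)%N) (p1 : 1 < p).
Local Notation N := n.+1.
Local Notation B := (@bochner_riesz R N (n%:R / 2)).

Lemma bochner_riesz_tests : exists b (M0 : nat), 0 < b /\ forall M, (M0 <= M)%N ->
  ((b * M%:R)%:E <= Lpw_opnorm p (@dyadic_weight R N M) B)%E /\
  ((b * M%:R)%:E <= Lpw_opnorm p (dual_power p (@dyadic_weight R N M)) B)%E.
Proof.
have [c [rho0 [c0 rho8 br_kernel_lower]]] := br_kernel_good R n0.
have [c1 [c10 good_lower]] := lebesgue_good R n.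
have pow2 (x : R) : exists k : nat, x <= 2 ^+ k.
  exists (Num.truncn x).+1; rewrite (le_trans (ltW (truncnS_gt x)))//.
  by rewrite -natrX ler_nat ltnW// ltn_expl.
have [k0 k0P] := pow2 rho0.
have [m0 m0P] := pow2 (80 * N%:R).
have m0P' : 80 * N%:R * 2^-1 ^+ m0 <= 1 :> R.
  by rewrite exprVn ler_pdivrMr ?exprn_gt0// mul1r.
pose b1 := c * c1 / 2 * (2 ^+ N / 2 / (2 ^+ N * 4)) `^ p^-1.
pose b2 := c * 2 ^+ N / 2 * (3 `^ (1 - p) * c1 / 2 / (2 ^+ N * 4)) `^ p^-1.
have N2 : 0 < 2 ^+ N :> R by rewrite exprn_gt0.
have b10 : 0 < b1 by rewrite !(mulr_gt0, powR_gt0, divr_gt0, invr_gt0).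
have b20 : 0 < b2 by rewrite !(mulr_gt0, powR_gt0, divr_gt0, invr_gt0).
exists (Num.min b1 b2), (2 * k0 + 2 * m0).+1; split; first by rewrite lt_min b10.
move=> M hM.
have hk : (2 * k0 <= M)%N by clear -hM; lia.
have hm : (2 * m0 <= M)%N by clear -hM; lia.
have h1 : (1 <= M)%N by clear -hM; lia.
split.
- apply: le_trans (opnorm_dyadic_weight n0 p1 c0 c10 rho8 k0P m0P' br_kernel_lower good_lower hk hm h1).
  by rewrite lee_fin ler_wpM2r// ge_min lexx.
- apply: le_trans (opnorm_dual_dyadic_weight n0 p1 c0 c10 rho8 k0P m0P' br_kernel_lower good_lower hk hm h1).
  by rewrite lee_fin ler_wpM2r// ge_min lexx orbT.
Qed.

(** [e] is the rate at which the Muckenhoupt constant of the family may grow with [M]: 1 for the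
    dyadic weight, [p - 1] for its dual. The norms grow at least linearly, so the power of [M] on
    the other side has exponent at least 1. *)
Lemma opnorm_bound_exponent (e : R) (v : nat -> euclid R N -> R) (b c : R) (M0 : nat) :
  0 < b ->
  (forall M, (M0 <= M)%N -> ((b * M%:R)%:E <= Lpw_opnorm p (v M) B)%E) ->
  (forall M, [/\ Ap p (v M), (1 <= Ap_const p (v M))%E &
     (Ap_const p (v M) <= ((8 ^+ N * (2 * M).+2%:R) `^ e)%:E)%E]) -> 0 <= e ->
  (forall M, (Lpw_opnorm p (v M) B <= c%:E * poweR (Ap_const p (v M)) beta)%E) ->
  1 <= e * Num.max beta 0.
Proof.
move=> b0 lower ApM e0 upper.
have g0 : 0 <= Num.max beta 0 by rewrite le_max lexx orbT.
(* [(2 * M).+2 <= 4 * M] for [M >= 1], whence the constant [8 ^+ N * 4]. *)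
apply: (@linear_growth _ b `|c| (8 ^+ N * 4) (e * Num.max beta 0) (maxn M0 1) b0).
- exact: normr_ge0.
- by rewrite mulr_gt0// exprn_gt0.
move=> M; rewrite geq_max => /andP[M0M M1].
have [ApM1 lb ub] := ApM M.
rewrite -lee_fin; apply: le_trans (lower M M0M) _; apply: le_trans (upper M) _.
apply: (@le_trans _ _ (`|c|%:E * poweR (Ap_const p (v M)) beta)%E).
  by rewrite lee_wpmul2r ?poweR_ge0// lee_fin ler_norm.
rewrite EFinM lee_wpmul2l ?lee_fin//.
apply: (le_trans (poweR_bound beta lb ub)); rewrite lee_fin -powRrM.
apply: ge0_ler_powR; rewrite ?nnegrE ?mulr_ge0 ?exprn_ge0//.
rewrite -mulrA ler_wpM2l ?exprn_ge0// -natrM ler_nat; clear -M1; lia.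
Qed.

End sharpness.

Theorem corollary3p3 (R : realType) (n : nat) (p beta : R)
    (n_ge2 : (2 <= n)%N) (p_gt1 : 1 < p)
    (bound : exists c : R, forall w : euclid R n -> R, Ap p w ->
       (Lpw_opnorm p w (bochner_riesz ((n%:R - 1) / 2))
          <= c%:E * poweR (Ap_const p w) beta)%E) :
  Num.max 1 (1 / (p - 1)) <= beta.
Proof.
case: n n_ge2 bound => [//|n] n_ge2 [c bound].
have n0 : (0 < n)%N by [].
have nE : (n.+1%:R - 1) / 2 = n%:R / 2 :> R by rewrite -natr1 addrK.
rewrite nE in bound.
have [b [M0 [b0 tests]]] := bochner_riesz_tests n0 p_gt1.
have pm1 : 0 < p - 1 by rewrite subr_gt0.
have h1 : 1 <= Num.max beta 0.
  rewrite -[leRHS]mul1r.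
  apply: (@opnorm_bound_exponent _ _ p beta 1 (fun M => @dyadic_weight R n.+1 M) b c M0 b0) => //.
  - by move=> M /tests[].
  - move=> M; rewrite powRr1; last by rewrite mulr_ge0// exprn_ge0.
    exact: Ap_dyadic_weight.
  - by move=> M; apply: bound; have [] := Ap_dyadic_weight (ltn0Sn n) p_gt1 M.
have h2 : 1 <= (p - 1) * Num.max beta 0.
  apply: (@opnorm_bound_exponent _ _ p beta (p - 1)
    (fun M => dual_power p (@dyadic_weight R n.+1 M)) b c M0 b0) => //.
  - by move=> M /tests[].
  - by move=> M; exact: Ap_dual_dyadic_weight.
  - exact: ltW.
  - by move=> M; apply: bound; have [] := Ap_dual_dyadic_weight (ltn0Sn n) p_gt1 M.
(* The first bound excludes [beta <= 0], where the maximum would be 0. *)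
have beta1 : Num.max beta 0 = beta.
  by apply: max_l; move: h1; rewrite le_max => /orP[]; lra.
rewrite beta1 in h1 h2.
by rewrite ge_max h1 ler_pdivrMr// mulrC.
Qed.
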